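(* Let $G$ be a non-abelian finite $p$-group of order $p^n$ with $|\mathcal{M}(G)|=p^{\frac12 n(n-1)-5}$. Then $n\le 7$. Moreover, if $n=7$ then $G\cong E_1\times\mathbb{Z}_p^{(4)}$ (with $p$ odd), and if $n=6$ then $G\cong D_8\times \mathbb{Z}_2^{(3)}$.
   Context: $\mathcal{M}(G)$ denotes the Schur multiplier of $G$. $\mathbb{Z}_{p}^{(m)}$ denotes the direct product of $m$ copies of the cyclic group of order $p$. $D_8$ is the dihedral group of order 8; for odd $p$, $E_1$ is the extra special group of order $p^3$ and exponent $p$. *)

(* Defs.v *)
From HB Require Import structures.
From mathcomp Require Import all_boot all_order all_algebra all_fingroup all_solvable all_field.
Set Implicit Arguments.
Unset Strict Implicit.
Unset Printing Implicit Defensive.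
Import GRing.Theory.

(* The Schur multiplier M(G) of a finite group G is H^2(G, C^x), with trivial
   action on the multiplicative group of the complex numbers.  We use the
   algebraic complex numbers algC (a finite group has all its 2-cocycle classes
   represented by cocycles with values in roots of unity, so algC^x gives the
   same H^2 as C^x; but we simply define H^2(G, algC^x) directly). *)

Section Schur.
Variable gT : finGroupType.

Definition is_2cocycle (G : {set gT}) (f : gT -> gT -> algC) : Prop :=
  (forall x y, x \in G -> y \in G -> f x y != 0%R) /\
  (forall x y z, x \in G -> y \in G -> z \in G ->
     (f y z * f x (y * z)%g = f (x * y)%g z * f x y)%R).

Definition cohomologous (G : {set gT}) (f g : gT -> gT -> algC) : Prop :=
  exists t : gT -> algC,
    (forall x, x \in G -> t x != 0%R) /\
    (forall x y, x \in G -> y \in G ->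
       f x y = (g x y * (t x * t y / t (x * y)%g))%R).

Definition schur_order (G : {set gT}) (m : nat) : Prop :=
  exists s : seq (gT -> gT -> algC),
    size s = m /\
    (forall i, i < m -> is_2cocycle G (nth (fun _ _ => 1%R) s i)) /\
    (forall i j, i < m -> j < m -> i <> j ->
       ~ cohomologous G (nth (fun _ _ => 1%R) s i) (nth (fun _ _ => 1%R) s j)) /\
    (forall f, is_2cocycle G f ->
       exists2 i, i < m & cohomologous G f (nth (fun _ _ => 1%R) s i)).
End Schur.

(* Main.v *)
(* For a central subgroup K = <k> of prime order p, a 2-cocycle f of G yields the character
   theta f k : g |-> f(k,g) / f(g,k) of G, and inflation and restriction give
   |M(G)| |G' cap K| = |M(G/K)| a, where a is the number of characters theta f k obtained.
   Such a character kills K and the Frattini subgroup of G, so a is at most p^d when G/K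
   needs d generators.  If K <= G' and G/K is not elementary abelian, induction on the order
   bounds |M(G)| well enough to exclude n >= 7, and a finer look at theta excludes n = 6.
   If G/K is elementary abelian of rank r = n - 1, then |M(G/K)| = p^(r(r-1)/2), and the
   hypothesis on |M(G)| becomes a = p^(n-5).  On the other hand the commutator pairing omega
   of G/K satisfies theta wedge omega = 0 (reversing a word x y z in the twisted group algebra
   gives the same scalar both ways), so theta is determined on a noncommuting pair and
   a <= p^2, whence n <= 7; moreover a > 1 forces Z(G) to have index p^2.  Also theta(x) = 1
   whenever x^p <> 1, so G has exponent p if p is odd, and a <= 2 if p = 2.  For odd p an
   explicit cocycle shows a = p^2; thus n = 7 means p odd and n = 6 means p = 2, and in both
   cases G is the direct product of <u, v>, for suitable noncommuting u and v, with a
   complement of K in Z(G). *)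
Require Import Defs.
From HB Require Import structures.
From mathcomp Require Import all_boot all_order all_algebra all_fingroup all_solvable all_field.
From mathcomp Require Import all_character.
From mathcomp Require Import boolp.
From mathcomp Require Import zify ring.
Set Implicit Arguments.
Unset Strict Implicit.
Unset Printing Implicit Defensive.

(** * Counting equivalence classes *)

Section Counting.

Definition equivalence_on (T : Type) (R : T -> T -> Prop) : Prop :=
  [/\ forall x, R x x, forall x y, R x y -> R y x
    & forall x y z, R x y -> R y z -> R x z].

(** A transversal stands in for the quotient set, so no type of cohomology classes is ever built.
    Any finite index type is allowed, which lets pairs of indices number the classes directly. *)
Definition nclass (T : Type) (S : T -> Prop) (R : T -> T -> Prop) (m : nat) : Prop :=
  exists (I : finType) (s : I -> T),
    [/\ #|I| = m, forall i, S (s i), forall i j, R (s i) (s j) -> i = j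
      & forall x, S x -> exists i, R x (s i)].

Lemma nclass_le (T T' : Type) (S : T -> Prop) (S' : T' -> Prop)
    (R : T -> T -> Prop) (R' : T' -> T' -> Prop) (phi : T -> T') a b :
    equivalence_on R' -> nclass S R a -> nclass S' R' b ->
    (forall x, S x -> S' (phi x)) ->
    (forall x y, S x -> S y -> R' (phi x) (phi y) -> R x y) ->
  a <= b.
Proof.
move=> [_ R'C R'T] [I [s [<- sS sR _]]] [J [s' [<- _ _ s'S]]] phiS phiR.
have /fin_all_exists[h hP] i : exists j, R' (phi (s i)) (s' j).
  exact: s'S (phiS _ (sS i)).
apply: (@leq_card _ _ h) => i1 i2 eq_h; apply/sR/phiR => //.
by apply: R'T (hP i1) _; rewrite eq_h; apply: R'C.
Qed.

Lemma nclass_uniq (T : Type) (S : T -> Prop) (R : T -> T -> Prop) a b :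
  equivalence_on R -> nclass S R a -> nclass S R b -> a = b.
Proof.
move=> eR Sa Sb; apply/anti_leq/andP.
by split; [apply: (nclass_le (phi := id) eR Sa Sb) | apply: (nclass_le (phi := id) eR Sb Sa)].
Qed.

Lemma nclass_leq_card (T : Type) (S : T -> Prop) (R : T -> T -> Prop) a
    (J : finType) (phi : T -> J) :
    nclass S R a -> (forall x y, S x -> S y -> phi x = phi y -> R x y) ->
  a <= #|J|.
Proof.
move=> [I [s [<- sS sR _]]] phiR.
by apply: (@leq_card _ _ (phi \o s)) => i j /= eq_phi; apply/sR/phiR.
Qed.

Lemma nclass_geq_card (T : Type) (S : T -> Prop) (R : T -> T -> Prop) a
    (J : finType) (F : J -> T) :
    equivalence_on R -> nclass S R a -> (forall j, S (F j)) ->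
    (forall i j, R (F i) (F j) -> i = j) ->
  #|J| <= a.
Proof.
move=> [_ RC RT] [I [s [<- _ _ sS]]] FS FR.
have /fin_all_exists[h hP] j : exists i, R (F j) (s i) by apply: sS.
apply: (@leq_card _ _ h) => i j eq_h; apply/FR/(RT _ _ _ (hP i)).
by rewrite eq_h; apply: RC.
Qed.

(** Finiteness comes from an invariant [phi] with finitely many values that separates classes, even
    when it is not constant on them. *)
Lemma nclass_exists (T : Type) (S : T -> Prop) (R : T -> T -> Prop)
    (J : finType) (phi : T -> J) :
    equivalence_on R -> (forall x y, S x -> S y -> phi x = phi y -> R x y) ->
  exists m, nclass S R m.
Proof.
move=> [RR RC RT] phiR.
(* [c x] selects a value of [phi] taken on the class of [x]. The predicate depends on that class
   only, so [c], unlike [phi], is constant on classes. *)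
pose c x := [pick j | `[< exists y, [/\ S y, phi y = j & R x y] >]].
have cR x y : S x -> S y -> (c x = c y <-> R x y).
  move=> Sx Sy; split=> [|Rxy]; last first.
    apply: eq_pick => j; apply: asbool_equiv_eq; split=> -[z [Sz pz Rz]].
      by exists z; split=> //; apply: RT (RC _ _ Rxy) Rz.
    by exists z; split=> //; apply: RT Rxy Rz.
  rewrite /c; case: pickP => [j /asboolP[z [Sz pz Rxz]]|/(_ (phi x))/asboolP[]]; last by exists x.
  case: pickP => // j' /asboolP[z' [Sz' pz' Ryz']] [eq_j].
  apply: RT Rxz (RT _ _ _ _ (RC _ _ Ryz')).
  by apply: phiR; rewrite // pz pz'.
pose D := [pred j : option J | `[< exists2 x, S x & c x = j >]].
have xD (j : {j | D j}) : {x | S x & c x = val j}.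
  by apply: cid2; case: j => j /= /asboolP.
exists #|{: {j | D j}}|, {j | D j}, (fun j => s2val (xD j)); split=> //.
- by move=> j; case: (xD j).
- move=> i j; case: (xD i) => x Sx cx; case: (xD j) => y Sy cy /= /cR-/(_ Sx Sy) e.
  by apply: val_inj; rewrite /= -cx -cy.
move=> x Sx; have Dx : D (c x) by apply/asboolP; exists x.
by exists (Sub (c x) Dx); case: (xD _) => y Sy cy /=; apply/cR.
Qed.

Lemma nclass_coarsen (T : Type) (S S2 : T -> Prop) (R R2 : T -> T -> Prop) m :
    equivalence_on R -> equivalence_on R2 -> nclass S R m -> (forall x, S2 x -> S x) ->
    (forall x y, R x y -> R2 x y) ->
  exists b, nclass S2 R2 b.
Proof.
move=> [RR RC RT] eR2 [I [s [_ sS _ sR]]] S2S RR2.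
apply: (@nclass_exists _ _ _ _ (fun x => [pick i | `[< R x (s i) >]])) eR2 _.
move=> x y /S2S/sR[i Rxi] _.
case: pickP => [j /asboolP Rxj|/(_ i)/asboolP] //; case: pickP => // j' /asboolP Ryj [eq_j].
by apply/RR2/(RT _ _ _ Rxj); rewrite eq_j; apply: RC.
Qed.

(** Two-stage counting as in Lagrange's theorem: first representatives of the coarse relation [R2],
    then [b] representatives of [R] inside each coarse class. *)
Lemma nclass_mul (T : Type) (S : T -> Prop) (R R2 : T -> T -> Prop) a b :
    equivalence_on R2 -> (forall x y, R x y -> R2 x y) ->
    nclass S R2 a ->
    (forall x, S x -> nclass (fun y => S y /\ R2 y x) R b) ->
  nclass S R (a * b).
Proof.
move=> [R2R R2C R2T] RR2 [I [s [<- sS sR2 S_s]]] fibb.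
have /fin_all_exists[t tP] i : exists t : 'I_b -> T,
    [/\ forall j, S (t j) /\ R2 (t j) (s i), forall j k, R (t j) (t k) -> j = k
      & forall x, S x /\ R2 x (s i) -> exists j, R x (t j)].
  have [J [t [<- tS tR S_t]]] := fibb _ (sS i).
  exists (t \o enum_val); split=> [j|j k /tR/enum_val_inj|x /S_t[j Rxj]] //=.
  by exists (enum_rank j); rewrite enum_rankK.
exists (I * 'I_b)%type, (fun u => t u.1 u.2); split.
- by rewrite card_prod card_ord.
- by move=> [i j] /=; case: (tP i) => /(_ j)[].
- move=> [i j] [i' j'] /= Rt.
  have [/(_ j)[_ Ri] tR _] := tP i; have [/(_ j')[_ Ri'] _ _] := tP i'.
  have eq_i : i = i' by apply/sR2/(R2T _ _ _ (R2C _ _ Ri))/(R2T _ _ _ (RR2 _ _ Rt)).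
  by subst i'; rewrite (tR _ _ Rt).
move=> x Sx; have [i Rxi] := S_s _ Sx.
have [_ _ /(_ x (conj Sx Rxi))[j Rxj]] := tP i.
by exists (i, j).
Qed.

End Counting.

(** * Cocycles and the pairing theta *)

Section Cocycles.
Import GRing.Theory Num.Theory.
Local Open Scope ring_scope.
Variables (gT : finGroupType) (G : {group gT}).
Implicit Types (f g : gT -> gT -> algC) (x y z k : gT).

Lemma cohomologous_equiv : equivalence_on (cohomologous G).
Proof.
split=> [f|f g [t [t0 E]]|f g h [t [t0 E]] [u [u0 F]]].
- by exists (fun=> 1); split=> [x|x y] _ *; rewrite ?oner_neq0 ?mulr1 ?divr1 ?mulr1.
- exists (fun x => (t x)^-1); split=> [x Gx|x y Gx Gy]; first by rewrite invr_eq0 t0.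
  rewrite E //; have [] : [/\ t x != 0, t y != 0 & t (x * y)%g != 0] by rewrite !t0 ?groupM.
  by move=> *; field; apply/and3P.
- exists (fun x => t x * u x); split=> [x Gx|x y Gx Gy].
    by rewrite mulf_neq0 ?t0 ?u0.
  rewrite E // F //; have [] : t (x * y)%g != 0 /\ u (x * y)%g != 0 by rewrite ?t0 ?u0 ?groupM.
  by move=> *; field; apply/andP.
Qed.

Lemma cocycle_cst1 : is_2cocycle G (fun _ _ => 1).
Proof. by split=> *; rewrite ?oner_neq0. Qed.

Lemma cocycle_mul f g :
  is_2cocycle G f -> is_2cocycle G g -> is_2cocycle G (fun x y => f x y * g x y).
Proof.
move=> [f0 fE] [g0 gE]; split=> [x y Gx Gy|x y z Gx Gy Gz].
  by rewrite mulf_neq0 ?f0 ?g0.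
by rewrite mulrACA fE // gE // mulrACA.
Qed.

Lemma cocycle_inv f : is_2cocycle G f -> is_2cocycle G (fun x y => (f x y)^-1).
Proof.
move=> [f0 fE]; split=> [x y Gx Gy|x y z Gx Gy Gz]; first by rewrite invr_eq0 f0.
by rewrite -!invfM fE.
Qed.

Lemma cocycle_div f g :
  is_2cocycle G f -> is_2cocycle G g -> is_2cocycle G (fun x y => f x y / g x y).
Proof. by move=> Gf /cocycle_inv; apply: cocycle_mul. Qed.

Lemma cocycle_exp f n : is_2cocycle G f -> is_2cocycle G (fun x y => f x y ^+ n).
Proof.
move=> [f0 fE]; split=> [x y Gx Gy|x y z Gx Gy Gz]; first by rewrite expf_neq0 ?f0.
by rewrite -!exprMn fE.
Qed.

Lemma coh_cocycle f g : cohomologous G f g -> is_2cocycle G g -> is_2cocycle G f.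
Proof.
move=> [t [t0 E]] [g0 gE]; split=> [x y Gx Gy|x y z Gx Gy Gz].
  by rewrite E // !mulf_neq0 ?g0 ?invr_eq0 ?t0 ?groupM.
rewrite !E ?groupM // mulgA.
have := gE _ _ _ Gx Gy Gz; have [] : t (x * y)%g != 0 /\ t (y * z)%g != 0 by rewrite !t0 ?groupM.
set T := t (x * y * z)%g; have : T != 0 by rewrite t0 ?groupM.
move=> ? ? ? e; rewrite mulrACA e; field; exact/and3P.
Qed.

Lemma coh_mulr f g h : cohomologous G f g ->
  cohomologous G (fun x y => f x y * h x y) (fun x y => g x y * h x y).
Proof.
by move=> [t [t0 E]]; exists t; split=> // x y Gx Gy; rewrite E // mulrAC.
Qed.

Lemma coh_div f g : is_2cocycle G g ->
  cohomologous G f g <-> cohomologous G (fun x y => f x y / g x y) (fun _ _ => 1).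
Proof.
move=> [g0 _]; split=> -[t [t0 E]]; exists t; split=> // x y Gx Gy.
  by rewrite E // mul1r mulrAC divff ?mul1r ?g0.
by have := E _ _ Gx Gy; rewrite mul1r => <-; rewrite mulrC divfK ?g0.
Qed.

Lemma coh_eq_in f g : {in G &, f =2 g} -> cohomologous G f g.
Proof.
move=> E; exists (fun=> 1); split=> [*|x y Gx Gy]; first exact: oner_neq0.
by rewrite E // divr1 !mulr1.
Qed.

Lemma coh_mull f g h : is_2cocycle G h ->
  cohomologous G (fun x y => h x y * f x y) (fun x y => h x y * g x y) -> cohomologous G f g.
Proof.
move=> [h0 _] [t [t0 E]]; exists t; split=> // x y Gx Gy.
by apply: (mulfI (h0 _ _ Gx Gy)); rewrite E // -[LHS]mulrA.
Qed.

Section MultiplicativeFunctions.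
Variable h : gT -> algC.
Hypotheses (h0 : forall x, x \in G -> h x != 0)
  (hM : forall x y, x \in G -> y \in G -> h (x * y)%g = h x * h y).

Lemma mul_fun1 : h 1%g = 1.
Proof.
by apply: (mulfI (h0 (group1 G))); rewrite -hM ?group1 // mulg1 mulr1.
Qed.

Lemma mul_ker_gen (A : {set gT}) : A \subset G ->
  (forall x, x \in A -> h x = 1) -> forall x, x \in <<A>>%g -> h x = 1.
Proof.
move=> sAG hA x.
have gK : group_set [set x in G | h x == 1].
  apply/group_setP; split=> [|y z]; rewrite !inE ?group1 ?mul_fun1 //=.
  move=> /andP[Gy /eqP ey] /andP[Gz /eqP ez].
  by rewrite groupM // hM // ey ez mulr1 /=.
have /subsetP/(_ x) : <<A>>%g \subset group gK.
  by rewrite gen_subG; apply/subsetP=> y Ay; rewrite inE (subsetP sAG) ?hA ?eqxx.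
by move=> /[apply]; rewrite inE => /andP[_ /eqP].
Qed.

Lemma mul_der1 x : x \in G^`(1)%g -> h x = 1.
Proof.
apply: mul_ker_gen => [|_ /imset2P[y z Gy Gz ->]].
  by apply/subsetP=> y /imset2P[u v Gu Gv ->]; rewrite groupR.
apply: (mulfI (h0 (groupM Gz Gy))).
rewrite -hM ?groupM ?groupV // /commg /conjg mulgA -(mulgA z) mulgV mulg1.
by rewrite mulgA mulgV mul1g mulr1 !hM // mulrC.
Qed.

End MultiplicativeFunctions.

Section Basics.
Variable f : gT -> gT -> algC.
Hypothesis Hf : is_2cocycle G f.

Lemma cocycle_nz x y : x \in G -> y \in G -> f x y != 0.
Proof. by case: Hf => f0 _; apply: f0. Qed.

Lemma cocycleE x y z : x \in G -> y \in G -> z \in G ->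
  f y z * f x (y * z)%g = f (x * y)%g z * f x y.
Proof. by case: Hf => _; apply. Qed.

Lemma cocyclex1 x : x \in G -> f x 1%g = f 1%g 1%g.
Proof.
move=> Gx; have := cocycleE Gx (group1 G) (group1 G); rewrite !mulg1.
by move/(mulIf (cocycle_nz Gx (group1 G))).
Qed.

Lemma cocycle1x x : x \in G -> f 1%g x = f 1%g 1%g.
Proof.
move=> Gx; have := cocycleE (group1 G) (group1 G) Gx; rewrite !mul1g.
by move/(mulfI (cocycle_nz (group1 G) Gx)).
Qed.

Lemma cocycle_expg_comm x i : x \in G -> f x (x ^+ i)%g = f (x ^+ i)%g x.
Proof.
move=> Gx; elim: i => [|i IH]; first by rewrite expg0 cocyclex1 // cocycle1x.
have := cocycleE Gx (groupX i Gx) Gx; rewrite -expgSr -expgS IH mulrC.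
by move/(mulIf (cocycle_nz (groupX i Gx) Gx)).
Qed.

(** In the twisted group algebra with basis [u_x] and product [u_x u_y = f x y u_(x y)], a central
    [k] satisfies [u_k u_x = theta f k x u_x u_k]. *)
Definition theta (f : gT -> gT -> algC) k x := f k x / f x k.

Lemma theta_nz k x : k \in G -> x \in G -> theta f k x != 0.
Proof. by move=> Gk Gx; rewrite /theta mulf_neq0 ?invr_eq0 ?cocycle_nz. Qed.

(** Conjugation by the basis element of [k] is an automorphism of the twisted group algebra that
    scales each basis element. Explicitly, three instances of the cocycle identity are combined
    through the centrality of [k]. *)
Lemma theta_mulr k x y : k \in 'Z(G)%g -> x \in G -> y \in G ->
  theta f k (x * y)%g = theta f k x * theta f k y.
Proof.
move=> /centerP[Gk kC] Gx Gy; rewrite /theta.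
have e1 := cocycleE Gk Gx Gy; have e2 := cocycleE Gx Gy Gk; have e3 := cocycleE Gx Gk Gy.
have -> : f k (x * y)%g = f (k * x)%g y * f k x / f x y.
  by rewrite -e1 mulrC mulKf ?cocycle_nz.
have -> : f (x * y)%g k = f y k * f x (y * k)%g / f x y.
  by rewrite e2 mulfK ?cocycle_nz.
rewrite (kC x) // -(kC y) //.
have -> : f (x * k)%g y = f k y * f x (k * y)%g / f x k.
  by rewrite e3 mulfK ?cocycle_nz.
by field; rewrite !cocycle_nz ?groupM.
Qed.

Lemma theta_mull k l x : k \in 'Z(G)%g -> l \in 'Z(G)%g -> x \in G ->
  theta f (k * l)%g x = theta f k x * theta f l x.
Proof.
move=> /centerP[Gk kC] /centerP[Gl lC] Gx; rewrite /theta.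
have e1 := cocycleE Gk Gl Gx; have e2 := cocycleE Gx Gk Gl; have e3 := cocycleE Gk Gx Gl.
have -> : f (k * l)%g x = f l x * f k (l * x)%g / f k l.
  by rewrite e1 mulfK ?cocycle_nz.
have -> : f x (k * l)%g = f (x * k)%g l * f x k / f k l.
  by rewrite -e2 mulrC mulKf ?cocycle_nz.
rewrite (lC x) // -(kC x) //.
have -> : f (k * x)%g l = f x l * f k (x * l)%g / f k x.
  by rewrite e3 mulfK ?cocycle_nz.
by field; rewrite !cocycle_nz ?groupM.
Qed.

Lemma theta1r k : k \in G -> theta f k 1%g = 1.
Proof. by move=> Gk; rewrite /theta cocyclex1 // cocycle1x // divff ?cocycle_nz. Qed.

Lemma theta1l x : x \in G -> theta f 1%g x = 1.
Proof. by move=> Gx; rewrite /theta cocyclex1 // cocycle1x // divff ?cocycle_nz. Qed.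

Lemma theta_expr k x i : k \in 'Z(G)%g -> x \in G ->
  theta f k (x ^+ i)%g = theta f k x ^+ i.
Proof.
move=> Zk Gx; have Gk := subsetP (center_sub G) _ Zk.
elim: i => [|i IH]; first by rewrite expg0 theta1r.
by rewrite expgS theta_mulr ?groupX // IH exprS.
Qed.

Lemma theta_expl k x i : k \in 'Z(G)%g -> x \in G ->
  theta f (k ^+ i)%g x = theta f k x ^+ i.
Proof.
move=> Zk Gx; elim: i => [|i IH]; first by rewrite expg0 theta1l.
by rewrite expgS theta_mull ?groupX // IH exprS.
Qed.

Lemma theta_expg_self x i : x \in G -> theta f (x ^+ i)%g x = 1.
Proof.
by move=> Gx; rewrite /theta cocycle_expg_comm // divff // cocycle_nz ?groupX.
Qed.

Lemma theta_unity k x : k \in 'Z(G)%g -> x \in G -> theta f k x ^+ #[k]%g = 1.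
Proof. by move=> Zk Gx; rewrite -theta_expl // expg_order theta1l. Qed.

Lemma theta_ker_gen k (A : {set gT}) : k \in 'Z(G)%g -> A \subset G ->
  (forall x, x \in A -> theta f k x = 1) -> forall x, x \in <<A>>%g -> theta f k x = 1.
Proof.
move=> Zk; have Gk := subsetP (center_sub G) _ Zk.
by apply: mul_ker_gen => [x|x y]; [apply: theta_nz | apply: theta_mulr].
Qed.

Lemma theta_der1 k x : k \in 'Z(G)%g -> x \in G^`(1)%g -> theta f k x = 1.
Proof.
move=> Zk; have Gk := subsetP (center_sub G) _ Zk.
by apply: mul_der1 => [{}x|{}x y]; [apply: theta_nz | apply: theta_mulr].
Qed.

Lemma theta_cycle k x : k \in 'Z(G)%g -> x \in <[k]>%g -> theta f k x = 1.
Proof.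
move=> Zk /cycleP[i ->]; have Gk := subsetP (center_sub G) _ Zk.
by rewrite theta_expr // (theta_expg_self 1) // expr1n.
Qed.

End Basics.
End Cocycles.

(** * Cocycles on cyclic subgroups and inflation from quotients *)

Section Inflation.
Import GRing.Theory Num.Theory.
Local Open Scope ring_scope.
Variables (gT : finGroupType) (G : {group gT}).
Implicit Types (f g : gT -> gT -> algC) (x y z k : gT).

(** Over an algebraically closed field the generator of the twisted group algebra of a cyclic group
    can be rescaled so that its [#[k]]-th power is the identity. This makes the multiplier of a
    cyclic group trivial. *)
Lemma cocycle_cycle_cobound f k : is_2cocycle G f -> k \in G ->
  exists c : gT -> algC, (forall x, x \in <[k]>%g -> c x != 0) /\
    (forall x y, x \in <[k]>%g -> y \in <[k]>%g -> f x y = c x * c y / c (x * y)%g).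
Proof.
move=> Hf Gk; have fnz := cocycle_nz Hf.
(* The [n]-th power of the basis element of [k] is [e n / f 1 1] times the basis element of
   [k ^+ n]. The factor [f 1 1] appears because [f] is not assumed to be normalised. *)
pose e n := \prod_(j < n) f (k ^+ j)%g k.
have e0 n : e n != 0 by apply/prodf_neq0=> j _; rewrite fnz ?groupX.
have e_0 : e 0%N = 1 by rewrite /e big_ord0.
have eS n : e n.+1 = e n * f (k ^+ n)%g k by rewrite /e big_ord_recr.
have f11 : f 1%g 1%g != 0 by rewrite fnz ?group1.
have fE i j : f (k ^+ i)%g (k ^+ j)%g = f 1%g 1%g * e (i + j)%N / (e i * e j).
  elim: j => [|j IH].
    by rewrite expg0 (cocyclex1 Hf) ?groupX // addn0 e_0 mulr1 mulfK.
  have := cocycleE Hf (groupX i Gk) (groupX j Gk) Gk.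
  rewrite -expgSr -expgD IH => E.
  apply: (mulfI (fnz _ _ (groupX j Gk) Gk)); rewrite E addnS !eS.
  by field; rewrite !e0 fnz ?groupX.
set N := #[k]%g; have N_gt0 : (0 < N)%N by apply: order_gt0.
have eN i : e (i + N)%N = e i * e N.
  elim: i => [|i IH]; first by rewrite add0n e_0 mul1r.
  by rewrite addSn !eS IH expgD expg_order mulg1 mulrAC.
(* Rescaling by [r] turns the [N]-th power of the generator into the identity. Hence [d] below is
   periodic and defines a function on [<[k]>]. *)
pose r := N.-root (e N)^-1; have rN : r ^+ N = (e N)^-1 by apply: rootCK.
have r0 : r != 0.
  have := e0 N; apply: contraNneq => r_eq0; move: rN.
  by rewrite r_eq0 expr0n gtn_eqF // => /esym/eqP; rewrite invr_eq0.
pose d i := f 1%g 1%g / (e i * r ^+ i).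
have d0 i : d i != 0 by rewrite /d !(mulf_neq0, invr_eq0) ?expf_neq0.
have dN i : d (i + N)%N = d i.
  by rewrite /d eN exprD rN; field; rewrite !e0 expf_neq0.
have dmod i : d (i %% N)%N = d i.
  rewrite {2}(divn_eq i N); elim: (i %/ N)%N => [|q IH]; first by rewrite mul0n.
  by rewrite mulSnr addnAC dN.
have /choice[ix ixP] x : exists i, x \in <[k]>%g -> x = (k ^+ i)%g.
  by have [/cycleP[i ->]|_] := boolP (x \in <[k]>%g); [exists i | exists 0%N].
exists (fun x => d (ix x)); split=> [x Kx|x y Kx Ky]; first exact: d0.
have -> : d (ix (x * y)%g) = d (ix x + ix y)%N.
  rewrite -dmod -[RHS]dmod; congr d; apply/eqP.
  by rewrite -eq_expg_mod_order -ixP ?groupM // expgD -!ixP.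
rewrite {1}(ixP _ Kx) {1}(ixP _ Ky) fE /d exprD; field.
by rewrite !e0 f11 !expf_neq0.
Qed.

(** Taking as basis the products of coset representatives with a genuine copy of [<[k]>] makes right
    multiplication by [<[k]>] untwisted; the triviality of [theta] carries this over to the left. *)
Lemma cocycle_fibre_trivial f k : is_2cocycle G f -> k \in 'Z(G)%g ->
    (forall x, x \in G -> theta f k x = 1) ->
  exists f2, [/\ cohomologous G f2 f, is_2cocycle G f2
    & forall x u, x \in G -> u \in <[k]>%g -> f2 x u = 1 /\ f2 u x = 1].
Proof.
move=> Hf Zk tf1; have /centerP[Gk kC] := Zk.
have sKG : <[k]>%g \subset G by rewrite cycle_subG.
have [c [c0 fc]] := cocycle_cycle_cobound Hf Gk.
have fnz := cocycle_nz Hf; set K := <[k]>%g in fc c0 sKG *.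
have f11 : f 1%g 1%g != 0 by rewrite fnz ?group1.
pose s x := repr (K :* x)%g; pose kp x := ((s x)^-1 * x)%g.
have sP x : exists2 u, u \in K & s x = (u * x)%g.
  by have /rcosetP := mem_repr_rcoset [group of K] x.
have uC u x : u \in K -> x \in G -> (u * x = x * u)%g.
  by move=> /cycleP[i ->] Gx; apply/esym/commuteX/esym/kC.
have kpK x : x \in G -> kp x \in K.
  move=> Gx; rewrite /kp; have [u Ku ->] := sP x.
  by rewrite invMg -(uC u^-1%g x^-1%g) ?groupV // -mulgA mulVg mulg1 groupV.
have Gs x : x \in G -> s x \in G.
  by move=> Gx; have [u Ku ->] := sP x; rewrite groupM // (subsetP sKG).
have sK u : u \in K -> s u = 1%g by move=> Ku; rewrite /s rcoset_id // repr_group.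
have sM x u : x \in G -> u \in K -> s (x * u)%g = s x.
  by move=> Gx Ku; rewrite /s -uC // rcosetM rcoset_id.
(* Rescaling by [t x] replaces the basis element of [x] by that of [s x] times the trivialised one
   of [kp x]. The division by [f 1 1] accounts for the basis element of [1] not being the
   identity. *)
pose t x := f (s x) (kp x) / (c (kp x) * f 1%g 1%g).
have t0 x : x \in G -> t x != 0.
  move=> Gx; rewrite /t !(mulf_neq0, invr_eq0) ?c0 ?kpK //.
  by rewrite fnz ?Gs // (subsetP sKG) ?kpK.
pose f2 x y := f x y * (t x * t y / t (x * y)%g).
have coh2 : cohomologous G f2 f by exists t.
have Hf2 := coh_cocycle coh2 Hf.
have f2xu x u : x \in G -> u \in K -> f2 x u = 1.
  move=> Gx Ku; have Gu := subsetP sKG _ Ku; have Kx := kpK _ Gx.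
  have Gkx := subsetP sKG _ Kx; have Kxu := groupM Kx Ku.
  rewrite /f2 /t sM // (sK u) //.
  have -> : kp (x * u)%g = (kp x * u)%g by rewrite /kp sM // mulgA.
  have -> : kp u = u by rewrite /kp sK // invg1 mul1g.
  rewrite (cocycle1x Hf) //.
  have := cocycleE Hf (Gs x Gx) Gkx Gu; have -> : (s x * kp x)%g = x by rewrite /kp mulKVg.
  rewrite (fc _ _ Kx Ku) => E.
  have -> : f (s x) (kp x * u)%g = f x u * f (s x) (kp x) * c (kp x * u)%g / (c (kp x) * c u).
    by rewrite -E; field; rewrite !c0.
  by field; rewrite f11 !c0 // !fnz ?Gs.
exists f2; split=> // x u Gx Ku; split; first exact: f2xu.
have Gu := subsetP sKG _ Ku.
rewrite -(f2xu x u) // /f2 uC // [t u * _]mulrC; congr (_ * _).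
have : theta f u x = 1.
  by case/cycleP: Ku => i ->; rewrite (theta_expl Hf) // tf1 // expr1n.
by move/divr1_eq.
Qed.

Section Quotient.
Variable K : {group gT}.
Hypothesis nKG : G \subset 'N(K)%g.

Definition inflate (h : coset_of K -> coset_of K -> algC) x y := h (coset K x) (coset K y).

Lemma inflate_cocycle h : is_2cocycle (G / K)%g h <-> is_2cocycle G (inflate h).
Proof.
have nK := subsetP nKG; split=> -[f0 fE]; split.
- by move=> x y Gx Gy; apply: f0; apply: mem_quotient.
- by move=> x y z Gx Gy Gz; rewrite /inflate !morphM ?nK //; apply: fE; apply: mem_quotient.
- by move=> _ _ /morphimP[x _ Gx ->] /morphimP[y _ Gy ->]; apply: f0.
- move=> _ _ _ /morphimP[x _ Gx ->] /morphimP[y _ Gy ->] /morphimP[z _ Gz ->].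
  by have := fE x y z Gx Gy Gz; rewrite /inflate !morphM ?nK.
Qed.

Lemma inflate_coh h l : cohomologous (G / K)%g h l -> cohomologous G (inflate h) (inflate l).
Proof.
move=> [t [t0 E]]; exists (t \o coset K); split=> [x Gx|x y Gx Gy] /=.
  by rewrite t0 ?mem_quotient.
by rewrite morphM ?(subsetP nKG) // /inflate E ?mem_quotient.
Qed.

End Quotient.

(** Exactness at M(G): once normalised on [<[k]>], a cocycle is invariant under translating either
    argument by [<[k]>], so coset representatives define a cocycle of the quotient. *)
Lemma theta_trivial_inflate f k : is_2cocycle G f -> k \in 'Z(G)%g ->
    (forall x, x \in G -> theta f k x = 1) ->
  exists2 f', is_2cocycle (G / <[k]>)%g f' & cohomologous G f (inflate (K := [group of <[k]>%g]) f').
Proof.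
move=> Hf Zk tf1; have [f2 [coh2 Hf2 f2K]] := cocycle_fibre_trivial Hf Zk tf1.
have /centerP[Gk kC] := Zk; have sKG : <[k]>%g \subset G by rewrite cycle_subG.
set K := [group of <[k]>%g]; have nKG : G \subset 'N(K)%g.
  by apply: subset_trans (cent_sub _); rewrite centsC cycle_subG; case/setIP: Zk.
have uC u x : u \in <[k]>%g -> x \in G -> (u * x = x * u)%g.
  by move=> /cycleP[i ->] Gx; apply/esym/commuteX/esym/kC.
have f2l x y u : x \in G -> y \in G -> u \in <[k]>%g -> f2 (u * x)%g y = f2 x y.
  move=> Gx Gy Ku; have Gu := subsetP sKG _ Ku; have := cocycleE Hf2 Gu Gx Gy.
  by rewrite (f2K _ _ (groupM Gx Gy) Ku).2 (f2K _ _ Gx Ku).2 !mulr1.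
have f2r x y u : x \in G -> y \in G -> u \in <[k]>%g -> f2 x (u * y)%g = f2 x y.
  move=> Gx Gy Ku; have Gu := subsetP sKG _ Ku; have := cocycleE Hf2 Gx Gy Gu.
  by rewrite (f2K _ _ (groupM Gx Gy) Ku).1 (f2K _ _ Gy Ku).1 !mul1r uC.
pose f' (a b : coset_of K) := f2 (repr a) (repr b).
have reprP x : x \in G -> exists2 u, u \in <[k]>%g & repr (coset K x) = (u * x)%g.
  move=> Gx; rewrite /= val_coset ?(subsetP nKG) //.
  by have /rcosetP := mem_repr_rcoset K x.
have infE x y : x \in G -> y \in G -> inflate f' x y = f2 x y.
  move=> Gx Gy; rewrite /inflate /f'.
  have [u Ku ->] := reprP _ Gx; have [v Kv ->] := reprP _ Gy.
  by rewrite f2l ?f2r ?groupM ?(subsetP sKG _ Kv).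
have [RR RC RT] := cohomologous_equiv G.
exists f'; last first.
  apply: RT (RC _ _ coh2) _; exists (fun=> 1).
  by split=> [*|x y Gx Gy]; rewrite ?oner_neq0 // infE // !divr1 !mulr1.
apply/(inflate_cocycle nKG); case: Hf2 => f20 f2E; split=> [x y Gx Gy|x y z Gx Gy Gz].
  by rewrite infE // f20.
by rewrite !infE ?groupM // f2E.
Qed.

End Inflation.

(** * Inflation from a central quotient *)

Section CentralStep.
Import GRing.Theory Num.Theory.
Local Open Scope ring_scope.
Variables (gT : finGroupType) (G : {group gT}) (k : gT).
Hypothesis Zk : k \in 'Z(G)%g.
Implicit Types (x y z : gT).
Let N := #[k]%g.
Let K := [group of <[k]>%g].

Let Gk : k \in G. Proof. by case/centerP: Zk. Qed.
Let kC x : x \in G -> (k * x = x * k)%g. Proof. by case/centerP: Zk => _ kC /kC. Qed.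
Let sKG : K \subset G. Proof. by rewrite cycle_subG. Qed.
Let nKG : G \subset 'N(K)%g.
Proof. by apply: subset_trans (cent_sub _); rewrite centsC cycle_subG; case/setIP: Zk. Qed.
Let uC u x : u \in K -> x \in G -> (u * x = x * u)%g.
Proof. by move=> /cycleP[i ->] Gx; apply/esym/commuteX/esym/kC. Qed.

Lemma theta_coh f g x : cohomologous G f g -> x \in G -> theta f k x = theta g k x.
Proof.
move=> [t [t0 E]] Gx; rewrite /theta !E // kC // [t x * _]mulrC.
have [-> | g0] := eqVneq (g x k) 0; first by rewrite mul0r !invr0 !mulr0.
by field; rewrite g0 !t0 ?groupM.
Qed.

Definition theta_eq f g := forall x, x \in G -> theta f k x = theta g k x.

Lemma theta_eq_equiv : equivalence_on theta_eq.
Proof.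
split=> [f x|f g E x Gx|f g h E F x Gx] //; first by rewrite E.
by rewrite E ?F.
Qed.

Lemma theta_mul f g x : theta (fun x y => f x y * g x y) k x = theta f k x * theta g k x.
Proof. by rewrite /theta invfM mulrACA. Qed.

Lemma theta_inv f x : theta (fun x y => (f x y)^-1) k x = (theta f k x)^-1.
Proof. by rewrite /theta invfM. Qed.

Lemma theta_inflate h x : is_2cocycle (G / K)%g h -> x \in G ->
  theta (inflate h) k x = 1.
Proof.
move=> Hh Gx; rewrite /theta /inflate [coset K k]coset_id ?cycle_id //.
have Qx : coset K x \in (G / K)%g by apply: mem_quotient.
by rewrite (cocycle1x Hh) ?(cocyclex1 Hh) // divff // (cocycle_nz Hh).
Qed.

(** The characters [theta f k] take values among the [N]-th roots of unity, so there are finitely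
    many of them. *)
Lemma nclass_theta : exists a, nclass (is_2cocycle G) theta_eq a.
Proof.
have [z z_prim] := C_prim_root_exists (order_gt0 k).
pose phi f := [ffun x : gT => [pick i : 'I_N | theta f k x == z ^+ i]].
apply: (nclass_exists (phi := phi) theta_eq_equiv) => f g Hf Hg eq_phi x Gx.
have [i fi] := prim_rootP z_prim (theta_unity Hf Zk Gx).
have [j gj] := prim_rootP z_prim (theta_unity Hg Zk Gx).
move/ffunP/(_ x): eq_phi; rewrite !ffunE; case: pickP => [i' /eqP ->|/(_ i)]; last by rewrite fi eqxx.
by case: pickP => // j' /eqP -> [->].
Qed.

Definition inflate_trivial (h : coset_of K -> coset_of K -> algC) :=
  is_2cocycle (G / K)%g h /\ cohomologous G (inflate h) (fun _ _ => 1).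

(* Exactness of M(G/K) -> M(G) -> Hom(G, K^), as an identity between orders:
   [b] is the order of the image of inflation. *)
Theorem central_step m' : nclass (is_2cocycle (G / K)%g) (cohomologous (G / K)%g) m' ->
  exists m a b c,
    [/\ nclass (is_2cocycle G) (cohomologous G) m, nclass (is_2cocycle G) theta_eq a,
        nclass inflate_trivial (cohomologous (G / K)%g) c, m = (a * b)%N & m' = (b * c)%N].
Proof.
move=> Qm'; have eG := cohomologous_equiv G; have eQ := cohomologous_equiv (G / K)%g.
have [RR RC RT] := eG.
(* [R2] identifies the cocycles of the quotient with cohomologous inflations, so its classes count
   the image of inflation. *)
pose R2 (f g : coset_of K -> coset_of K -> algC) := cohomologous G (inflate f) (inflate g).
have eR2 : equivalence_on R2.
  by split=> [f|f g|f g h]; [apply: RR | apply: RC | apply: RT].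
have R_R2 f g : cohomologous (G / K)%g f g -> R2 f g by apply: inflate_coh.
have [a Ga] := nclass_theta.
have [b Qb] := nclass_coarsen eQ eR2 Qm' (fun _ => id) R_R2.
have [c Qc] : exists c, nclass inflate_trivial (cohomologous (G / K)%g) c.
  by apply: (nclass_coarsen eQ eQ Qm' _ (fun _ _ => id)) => f [].
exists (a * b)%N, a, b, c; split=> //.
  (* Up to coboundaries, the cocycles with the same [theta] as [f] are the products of [f] with
     inflated cocycles. *)
  apply: (nclass_mul theta_eq_equiv _ Ga) => [f g /theta_coh cfg x /cfg //|f Hf].
  have [I [s [cI sZ sR Zs]]] := Qb.
  exists I, (fun i x y => f x y * inflate (s i) x y); split=> // [i|i j|g [Hg tgf]].
  - split; first by apply: cocycle_mul => //; apply/inflate_cocycle.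
    by move=> x Gx; rewrite theta_mul theta_inflate ?mulr1.
  - by move/(coh_mull Hf)/sR.
  have [] := theta_trivial_inflate (cocycle_div Hg Hf) Zk.
    by move=> x Gx; rewrite theta_mul theta_inv tgf // divff // (theta_nz Hf).
  move=> h Hh gh; have [i hi] := Zs _ Hh; exists i.
  apply: (coh_mull (cocycle_inv Hf)); apply: (RT _ _ _ _ (RT _ _ _ (RT _ _ _ gh hi) _)).
    by apply: coh_eq_in => x y Gx Gy; rewrite mulrC.
  by apply: coh_eq_in => x y Gx Gy; rewrite mulKf // (cocycle_nz Hf).
(* Likewise each class of [R2] is a coset of the kernel of inflation. *)
apply: (nclass_uniq eQ Qm'); apply: (nclass_mul eR2 R_R2 Qb) => f Hf.
have Hif : is_2cocycle G (inflate f) by apply/inflate_cocycle.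
have [I [s [cI sZ sR Zs]]] := Qc.
exists I, (fun i (x y : coset_of K) => f x y * s i x y).
split=> // [i|i j /(coh_mull Hf)/sR //|g [Hg gf]].
- have [Hs s1] := sZ i; split; first exact: cocycle_mul.
  rewrite /R2 /inflate; apply: (RT _ _ _ _ (RT _ _ _ (coh_mulr (inflate f) s1) _)).
    by apply: coh_eq_in => x y Gx Gy; rewrite /inflate mulrC.
  by apply: coh_eq_in => x y Gx Gy; rewrite mul1r.
have [|i gi] := Zs (fun x y : coset_of K => g x y / f x y).
  split; first exact: cocycle_div.
  exact/(coh_div _ Hif).
exists i; have [_ _ QT] := eQ.
apply: (coh_mull (cocycle_inv Hf)); apply: (QT _ _ _ _ (QT _ _ _ gi _)).
  by apply: coh_eq_in => x y Gx Gy; rewrite mulrC.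
by apply: coh_eq_in => x y Gx Gy; rewrite mulKf // (cocycle_nz Hf).
Qed.


(* A character of K yields a class of M(G/K) by transgression; these classes
   fill the kernel of inflation, and are distinct when K <= G'. *)
Lemma inflate_trivial_der1 : k \in G^`(1)%g ->
  nclass inflate_trivial (cohomologous (G / K)%g) N.
Proof.
move=> G'k; have [z z_prim] := C_prim_root_exists (order_gt0 k).
have nK := subsetP nKG.
have /choice[ix ixP] x : exists i, x \in K -> x = (k ^+ i)%g.
  by have [/cycleP[i ->]|_] := boolP (x \in K); [exists i | exists 0%N].
pose chi i u := z ^+ (i * ix u).
have z0 : z != 0.
  apply/eqP=> z_eq; have := prim_expr_order z_prim.
  by rewrite z_eq expr0n gtn_eqF // => /esym/eqP; rewrite oner_eq0.
have chi0 i u : chi i u != 0 by rewrite expf_neq0.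
have chiE i n : chi i (k ^+ n)%g = z ^+ (i * n).
  apply/eqP; rewrite (eq_prim_root_expr z_prim) -modnMmr; apply/eqP.
  rewrite -[RHS]modnMmr; congr (_ * _ %% _)%N; apply/eqP.
  by rewrite -eq_expg_mod_order -ixP // mem_cycle.
have chiM i u v : u \in K -> v \in K -> chi i (u * v)%g = chi i u * chi i v.
  by move=> /cycleP[m ->] /cycleP[n ->]; rewrite -expgD !chiE mulnDr exprD.
pose s x := repr (coset K x); pose kp x := ((s x)^-1 * x)%g.
have sP x : x \in G -> exists2 u, u \in K & s x = (u * x)%g.
  move=> Gx; rewrite /s /= val_coset ?nK //.
  by have /rcosetP := mem_repr_rcoset K x.
have Gs x : x \in G -> s x \in G.
  by move=> Gx; have [u Ku ->] := sP x Gx; rewrite groupM // (subsetP sKG).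
have kpK x : x \in G -> kp x \in K.
  move=> Gx; rewrite /kp; have [u Ku ->] := sP x Gx.
  by rewrite invMg -(uC (u := u^-1%g) (x := x^-1%g)) ?groupV // -mulgA mulVg mulg1 groupV.
have skp x : x = (s x * kp x)%g by rewrite /kp mulKVg.
have sM x u : x \in G -> u \in K -> s (x * u)%g = s x.
  move=> Gx Ku; rewrite /s -uC //; congr (repr (val _)).
  by rewrite morphM ?nK ?(subsetP sKG _ Ku) // [X in (X * _)%g]coset_id // mul1g.
have kpR x u : x \in G -> u \in K -> kp (x * u)%g = (kp x * u)%g.
  by move=> Gx Ku; rewrite /kp sM // mulgA.
have kpu u : u \in K -> kp u = u.
  by move=> Ku; rewrite /kp /s coset_id // repr_coset1 invg1 mul1g.
clearbody kp.
have kpM x y : x \in G -> y \in G -> kp (x * y)%g = (kp (s x * s y) * kp x * kp y)%g.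
  move=> Gx Gy; have Gxy := groupM (Gs x Gx) (Gs y Gy).
  rewrite -mulgA -(kpR (s x * s y)%g (kp x * kp y)%g) ?groupM ?Gs ?kpK //.
  rewrite {1}(skp x) {1}(skp y); congr kp.
  by rewrite !mulgA; congr (_ * _)%g; rewrite -!mulgA (uC (kpK x Gx)) // Gs.
(* [h i] is the inverse of [chi i] applied to the factor set of [G] over [G / K]. Its inflation is
   the coboundary of [chi i \o kp]. *)
pose h i (a b : coset_of K) := (chi i (kp (repr a * repr b)%g))^-1.
have hE i x y : x \in G -> y \in G -> inflate (h i) x y
    = 1 * (chi i (kp x) * chi i (kp y) / chi i (kp (x * y)%g)).
  move=> Gx Gy; have Gss := groupM (Gs x Gx) (Gs y Gy).
  rewrite kpM // !chiM ?groupM ?kpK //.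
  rewrite /inflate /h -/(s x) -/(s y); field.
  by rewrite !chi0.
have hT i : inflate_trivial (h i).
  have ch : cohomologous G (inflate (h i)) (fun _ _ => 1).
    by exists (fun x => chi i (kp x)); split=> // x y Gx Gy; apply: hE.
  by split=> //; apply/inflate_cocycle => //; apply: coh_cocycle ch (cocycle_cst1 G).
exists 'I_N, (fun i : 'I_N => h i); split=> // [|i j [t [t0 E]]|f [Hf [t [t0 E]]]].
- exact: card_ord.
(* A function linking [h i] to [h j] makes [H] multiplicative on [G]. Then [H k = 1] because [k]
   lies in the derived subgroup, and this forces [z ^+ i = z ^+ j]. *)
- pose H x := chi i (kp x) / (chi j (kp x) * t (coset K x)).
  have H0 x : x \in G -> H x != 0.
    by move=> Gx; rewrite !(mulf_neq0, invr_eq0) ?chi0 ?t0 ?mem_quotient.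
  have HM x y : x \in G -> y \in G -> H (x * y)%g = H x * H y.
    move=> Gx Gy; have := E (coset K x) (coset K y).
    rewrite -![h _ _ _]/(inflate (h _) x y) !hE // -morphM ?nK // !mem_quotient //.
    move=> /(_ isT isT) Exy; rewrite /H.
    apply: (mulIf (_ : (chi i (kp x) * chi i (kp y) / chi i (kp (x * y)%g)) != 0)).
      by rewrite !(mulf_neq0, invr_eq0).
    rewrite -[X in _ = _ * X]mul1r Exy; field.
    by rewrite !chi0 !t0 ?mem_quotient ?groupM.
  have kk : kp k = (k ^+ 1)%g by rewrite kpu ?cycle_id.
  have k1 : kp 1%g = (k ^+ 0)%g by rewrite kpu.
  have := mul_der1 H0 HM G'k; rewrite -(mul_fun1 H0 HM) /H kk k1 coset_id ?cycle_id //.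
  rewrite morph1 !chiE !muln1 !muln0 !expr0 !invfM !mulrA divr1.
  have t1 : t 1%g != 0 by rewrite t0.
  move=> e; have /eqP : z ^+ i = z ^+ j.
    apply: (mulIf (_ : (z ^+ j * t 1%g)^-1 != 0)).
      by rewrite invr_eq0 mulf_neq0 ?expf_neq0.
    by rewrite invfM !mulrA e divff ?expf_neq0.
  by rewrite (eq_prim_root_expr z_prim) !modn_small // => /eqP/val_inj.
have t1 : t 1%g != 0 by rewrite t0.
(* Conversely, a function trivialising an inflated cocycle restricts to [K], after division by its
   value at [1], as some character [chi i]. *)
have tM x u : x \in G -> u \in K -> t (x * u)%g = t x * (t u / t 1%g).
  move=> Gx Ku; have Gu := subsetP sKG _ Ku.
  have := E x u Gx Gu; rewrite /inflate [coset K u]coset_id // (cocyclex1 Hf) ?mem_quotient //.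
  have := E 1%g 1%g (group1 G) (group1 G); rewrite /inflate morph1 mulg1 => ->.
  rewrite !mul1r mulfK // => ->.
  by field; rewrite !t0 ?groupM.
have tk n : t (k ^+ n)%g / t 1%g = (t k / t 1%g) ^+ n.
  elim: n => [|n IH]; first by rewrite expg0 divff.
  rewrite expgSr tM ?groupX ?cycle_id // mulrAC IH exprSr //.
have [i ti] : {i : 'I_N | t k / t 1%g = z ^+ i}.
  by apply: (prim_rootP z_prim); rewrite -tk expg_order divff.
have chit u : u \in K -> t u / t 1%g = chi i u.
  by move=> /cycleP[n ->]; rewrite tk ti chiE exprM.
exists i; exists (fun a : coset_of K => t (repr a)).
have rG a : a \in (G / K)%g -> repr a \in G.
  by move=> /morphimP[x _ Gx ->]; apply: Gs.
split=> [a Qa|a b Qa Qb]; first by rewrite t0 ?rG.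
have Gab := groupM (rG a Qa) (rG b Qb).
have := E _ _ (rG a Qa) (rG b Qb); rewrite /inflate !coset_reprK => ->.
have sab : s (repr a * repr b)%g = repr (a * b)%g.
  by rewrite /s morphM ?nK ?rG //= !coset_reprK.
rewrite {1}(skp (repr a * repr b)%g) tM ?Gs ?kpK // chit ?kpK // sab /h.
have trab : t (repr (a * b)%g) != 0 by rewrite -sab t0 ?Gs.
by field; rewrite chi0 trab.
Qed.

End CentralStep.

(** * Bounding the number of characters theta *)

Section ThetaCount.
Import GRing.Theory Num.Theory.
Local Open Scope ring_scope.
Variables (gT : finGroupType) (G : {group gT}) (k : gT).
Hypothesis Zk : k \in 'Z(G)%g.
Implicit Types (x y z : gT).

(** Passing to the quotient of two cocycles reduces equality of characters to triviality. Each of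
    the [size S] values then ranges over [#[k]] roots of unity. *)
Lemma nclass_theta_leq a (S : seq gT) :
    nclass (is_2cocycle G) (theta_eq G k) a -> {subset S <= G} ->
    (forall f, is_2cocycle G f -> (forall x, x \in S -> theta f k x = 1) ->
       forall x, x \in G -> theta f k x = 1) ->
  (a <= #[k]%g ^ size S)%N.
Proof.
move=> Ga sSG detS; have [z z_prim] := C_prim_root_exists (order_gt0 k).
pose i0 := Ordinal (order_gt0 k).
pose phi (f : gT -> gT -> algC) := [ffun j : 'I_(size S) =>
  odflt i0 [pick i : 'I_(#[k]%g) | theta f k (tnth (in_tuple S) j) == z ^+ i]].
have -> : (#[k]%g ^ size S)%N = #|{ffun 'I_(size S) -> 'I_(#[k]%g)}|.
  by rewrite card_ffun !card_ord.
have phiP f (j : 'I_(size S)) : is_2cocycle G f ->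
    theta f k (tnth (in_tuple S) j) = z ^+ phi f j.
  move=> Hf; rewrite ffunE; case: pickP => [i /eqP //|].
  have Gx : tnth (in_tuple S) j \in G by rewrite sSG // (tnth_nth 1%g) mem_nth.
  by have [i ->] := prim_rootP z_prim (theta_unity Hf Zk Gx) => /(_ i); rewrite eqxx.
apply: (nclass_leq_card (phi := phi) Ga) => f g Hf Hg eq_phi x Gx.
apply: divr1_eq; rewrite -theta_inv -theta_mul.
apply: detS => [|{Gx}x Sx|//]; first exact: cocycle_div.
have /tnthP[j ->] : x \in in_tuple S by [].
rewrite theta_mul theta_inv !phiP // eq_phi divff // -phiP // (theta_nz Hg) //.
  by case/centerP: Zk.
by rewrite sSG // (tnth_nth 1%g) mem_nth.
Qed.

Lemma nclass_theta_geq a (J : finType) (F : J -> gT -> gT -> algC) :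
    nclass (is_2cocycle G) (theta_eq G k) a -> (forall j, is_2cocycle G (F j)) ->
    (forall i j, theta_eq G k (F i) (F j) -> i = j) ->
  (#|J| <= a)%N.
Proof. exact/nclass_geq_card/theta_eq_equiv. Qed.

(** A complement of [<[k]>] provides a homomorphic section of the quotient map; composing a
    trivialising function with it shows that inflation is injective. *)
Lemma inflate_trivial_compl (H : {group gT}) :
    [group of <[k]>%g] :&: H = 1%g -> ([group of <[k]>%g] * H)%g = G ->
  nclass (@inflate_trivial gT G k) (cohomologous (G / [group of <[k]>%g])%g) 1.
Proof.
set K := [group of _] => tiKH defG.
have sHG : H \subset G by rewrite -defG mulG_subr.
have nKG : G \subset 'N(K)%g.
  by apply: subset_trans (cent_sub _); rewrite centsC cycle_subG; case/setIP: Zk.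
have nKH := subset_trans sHG nKG; have nK := subsetP nKH.
exists unit, (fun _ _ _ => 1); split=> [|_|[] []|f [Hf [t [t0 E]]]] //.
- by rewrite card_unit.
- split; first exact: cocycle_cst1.
  exact: coh_eq_in.
exists tt.
have /choice[s sP] (a : coset_of K) : exists x, a \in (G / K)%g -> x \in H /\ coset K x = a.
  have [|_] := boolP (a \in (G / K)%g); last by exists 1%g.
  by rewrite -defG quotientMidl => /morphimP[x _ Hx ->]; exists x.
exists (fun a => t (s a)); split=> [a Qa|a b Qa Qb].
  by have [Hs _] := sP a Qa; rewrite t0 ?(subsetP sHG).
have [Ha ca] := sP a Qa; have [Hb cb] := sP b Qb; have [Hab cab] := sP _ (groupM Qa Qb).
have -> : s (a * b)%g = (s a * s b)%g.
  have Hs : ((s (a * b))^-1 * (s a * s b))%g \in H by rewrite !groupM ?groupV.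
  apply/eqP; rewrite eq_mulVg1 -in_set1 -set1gE -tiKH inE Hs andbT.
  apply: coset_idr; first exact: (subsetP nKH).
  have na := nK _ Ha; have nb := nK _ Hb; have nab := nK _ Hab.
  by rewrite morphM ?groupV ?groupM // morphV // morphM //= cab ca cb mulVg.
by rewrite -E ?(subsetP sHG) // /inflate ca cb.
Qed.

End ThetaCount.

(** * Generating a p-group over a subgroup *)

Section GenerationCount.
Local Open Scope group_scope.
Variables (gT : finGroupType) (p : nat).
Implicit Types (G H L : {group gT}).

Lemma pgroup_proper_card G H : p.-group G -> H \proper G -> (p * #|H| <= #|G|)%N.
Proof.
move=> pG /andP[sHG not_sGH]; rewrite -(Lagrange sHG) mulnC leq_mul2l orbC.
have [q_gt1 dvq] : (#|G : H| > 1 /\ p.-nat #|G : H|)%N.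
  by rewrite indexg_gt1 not_sGH (pnat_dvd (dvdn_indexg G H)).
case/p_natP: dvq q_gt1 => -[|i] -> // pi_gt1; rewrite expnS leq_pmulr //.
by move: (ltnW pi_gt1); rewrite expnS muln_gt0 => /andP[].
Qed.

(** Each new generator multiplies the order of the subgroup by at least [p]. *)
Lemma pgroup_gen_seq G H : p.-group G -> H \subset G ->
  exists S : seq gT, [/\ {subset S <= G}, G \subset <<H :|: [set x in S]>>
    & (p ^ size S * #|H| <= #|G|)%N].
Proof.
move=> pG; have [n] := ubnP (#|G| - #|H|)%N; elim: n H => // n IH H lenn sHG.
have [sGH | not_sGH] := boolP (G \subset H).
  exists [::]; split=> //; first by rewrite (subset_trans sGH) // sub_gen // subsetUl.
  by rewrite mul1n subset_leq_card.
have [x Gx notHx] := subsetPn not_sGH.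
pose L := [group of <<x |: H>>].
have sLG : L \subset G by rewrite gen_subG subUset sub1set Gx.
have prHL : H \proper L.
  rewrite properE sub_gen ?subsetUr //=.
  by apply: contra notHx => /subsetP->//; rewrite mem_gen ?setU11.
have [S [sSG genS leS]] : exists S : seq gT, [/\ {subset S <= G},
    G \subset <<L :|: [set x in S]>> & (p ^ size S * #|L| <= #|G|)%N].
  apply: IH => //; move: lenn; rewrite ltnS; apply: leq_trans.
  by rewrite ltn_sub2l // (leq_trans (proper_card prHL)) ?subset_leq_card.
exists (x :: S); split.
- by move=> y /predU1P[->|/sSG].
- apply: subset_trans genS _; rewrite gen_subG subUset gen_subG subUset sub1set.
  rewrite -!andbA; apply/and3P; split.
  + by rewrite mem_gen // !inE eqxx orbT.
  + by rewrite sub_gen ?subsetUl.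
  by apply/subsetP=> y; rewrite !inE => Sy; rewrite mem_gen // !inE Sy !orbT.
apply: leq_trans leS; rewrite /= expnS mulnAC mulnC.
by rewrite leq_mul2l (pgroup_proper_card (pgroupS sLG pG)) ?orbT.
Qed.

(** The values at [S0] settle [theta] on [H], and each further generator of [G] over [H] costs one
    more value. The product form avoids logarithms of indices. *)
Lemma theta_count_leq G H k a (S0 : seq gT) :
    p.-group G -> k \in 'Z(G) -> #[k] = p ->
    nclass (is_2cocycle G) (theta_eq G k) a -> H \subset G -> {subset S0 <= G} ->
    (forall f, is_2cocycle G f -> (forall x, x \in S0 -> theta f k x = 1%R) ->
       forall x, x \in H -> theta f k x = 1%R) ->
  (a * #|H| <= p ^ size S0 * #|G|)%N.
Proof.
move=> pG Zk ok Ga sHG sS0 detH; have [S [sSG genS leS]] := pgroup_gen_seq pG sHG.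
have: (a <= #[k] ^ size (S0 ++ S))%N.
  apply: (nclass_theta_leq Zk Ga) => [x|f Hf tf x Gx].
    by rewrite mem_cat => /orP[/sS0|/sSG].
  apply: (theta_ker_gen Hf Zk (A := H :|: [set x in S])).
  - by rewrite subUset sHG; apply/subsetP=> y; rewrite inE => /sSG.
  - move=> y; rewrite !inE => /orP[|Sy]; last by rewrite tf // mem_cat Sy orbT.
    by apply: detH => // u Su; rewrite tf // mem_cat Su.
  exact: (subsetP genS).
rewrite ok size_cat expnD => lea.
apply: leq_trans (leq_mul lea (leqnn _)) _.
by rewrite -mulnA leq_mul2l leS orbT.
Qed.

End GenerationCount.

(** * The twisted regular representation *)

Section TwistedRegular.
Import GRing.Theory Num.Theory.
Local Open Scope ring_scope.
Variables (gT : finGroupType) (G : {group gT}) (f : gT -> gT -> algC).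
Hypothesis Hf : is_2cocycle G f.
Implicit Types (x y z : gT).

(** This is right multiplication by the basis element of [x] on the twisted group algebra, acting on
    row vectors. *)
Definition twisted_mx x : 'M[algC]_#|G| :=
  \matrix_(i, j) (f (enum_val i) x *+ (enum_val j == enum_val i * x)%g).
Let U := twisted_mx.

Lemma twisted_mxM x y : x \in G -> y \in G -> U x *m U y = f x y *: U (x * y)%g.
Proof.
move=> Gx Gy; apply/matrixP=> i l; rewrite !mxE.
have Gi := enum_valP i; have Gix := groupM Gi Gx.
rewrite (bigD1 (enum_rank_in Gix (enum_val i * x)%g)) //= big1 => [|j ne_j].
  rewrite addr0 !mxE enum_rankK_in // eqxx mulr1n mulgA !mulrnAr.
  by rewrite mulrC -(cocycleE Hf Gi Gx Gy).
rewrite !mxE; case: eqP => [eq_j|]; last by rewrite mul0r.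
by case/eqP: ne_j; apply: enum_val_inj; rewrite enum_rankK_in.
Qed.

Lemma twisted_mx_scaler_inj x a b : x \in G -> a *: U x = b *: U x -> a = b.
Proof.
move=> Gx; pose i := enum_rank_in (group1 G) 1%g; pose j := enum_rank_in (group1 G) x.
move/matrixP/(_ i j); rewrite !mxE !enum_rankK_in // mul1g eqxx mulr1n.
by apply: mulIf; rewrite (cocycle_nz Hf).
Qed.

End TwistedRegular.

Section Hexagon.
Import GRing.Theory Num.Theory.
Local Open Scope ring_scope.
Variables (gT : finGroupType) (G : {group gT}) (f : gT -> gT -> algC).
Hypothesis Hf : is_2cocycle G f.

(* In the twisted group algebra, reversing the word x y z in the two possible
   orders must give the same scalar. *)
Lemma theta_hexagon (x y z c d e : gT) : x \in G -> y \in G -> z \in G ->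
    c \in 'Z(G)%g -> d \in 'Z(G)%g -> e \in 'Z(G)%g ->
    theta f c d = 1 -> theta f c e = 1 -> theta f d e = 1 ->
    (x * y = y * x * c)%g -> (y * z = z * y * d)%g -> (x * z = z * x * e)%g ->
  theta f c z * theta f d x = theta f e y.
Proof.
move=> Gx Gy Gz Zc Zd Ze tcd tce tde xy yz xz.
pose U := twisted_mx G f; have fnz := cocycle_nz Hf.
have [/centerP[Gc cC] /centerP[Gd dC]] := (conj Zc Zd); have /centerP[Ge eC] := Ze.
have UM u v : u \in G -> v \in G -> U u *m U v = f u v *: U (u * v)%g by apply: twisted_mxM.
have rel u v w : u \in G -> v \in G -> w \in G -> (u * v = v * u * w)%g ->
    exists2 a, a != 0 & U u *m U v = a *: (U v *m U u *m U w).
  move=> Gu Gv Gw uv; exists (f u v / (f v u * f (v * u)%g w)).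
    by rewrite !(mulf_neq0, invr_eq0) ?fnz ?groupM.
  rewrite UM // UM // -scalemxAl UM ?groupM // !scalerA uv; congr (_ *: _).
  by field; rewrite !fnz ?groupM.
have cen u v : u \in 'Z(G)%g -> v \in G -> U u *m U v = theta f u v *: (U v *m U u).
  move=> /centerP[Gu uC] Gv; rewrite !UM // scalerA uC //; congr (_ *: _).
  by rewrite /theta divfK ?fnz.
have [a a0 XY] := rel _ _ _ Gx Gy Gc xy.
have [b b0 YZ] := rel _ _ _ Gy Gz Gd yz.
have [g g0 XZ] := rel _ _ _ Gx Gz Ge xz.
have CZ := cen _ _ Zc Gz; have DX := cen _ _ Zd Gx; have EY := cen _ _ Ze Gy.
have CD := cen _ _ Zc Gd; have CE := cen _ _ Zc Ge; have DE := cen _ _ Zd Ge.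
rewrite tcd scale1r in CD; rewrite tce scale1r in CE; rewrite tde scale1r in DE.
pose M := U z *m U y *m U x *m (U d *m U e *m U c).
(* Here [x y] is exchanged first, then [x z], then [y z]: [c] has to pass [z] and [d] has to pass
   [x]. *)
have E1 : U x *m U y *m U z = (a * theta f c z * g * b * theta f d x) *: M.
  rewrite XY -scalemxAl -!mulmxA CZ -!scalemxAr !scalerA [U x *m _]mulmxA XZ.
  rewrite -!scalemxAl -!scalemxAr !scalerA -!mulmxA [U y *m _]mulmxA YZ.
  rewrite -!scalemxAl !scalerA -!mulmxA [U d *m _]mulmxA DX.
  by rewrite -!scalemxAl -!scalemxAr !scalerA /M -!mulmxA.
(* Here [y z] is exchanged first, then [x z], then [x y]. Only moving [e] past [y] costs a scalar,
   as [c], [d] and [e] have trivial [theta] among themselves. *)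
have E2 : U x *m U y *m U z = (b * g * theta f e y * a) *: M.
  rewrite -mulmxA YZ -scalemxAr !mulmxA XZ -!scalemxAl !scalerA -!mulmxA.
  rewrite [U e *m _]mulmxA EY -!scalemxAl -!scalemxAr !scalerA -!mulmxA.
  rewrite [U x *m _]mulmxA XY -!scalemxAl -!scalemxAr !scalerA /M -!mulmxA.
  by rewrite [U c *m _]mulmxA CE -mulmxA CD [U d *m (U e *m _)]mulmxA DE -mulmxA.
(* [M] is a nonzero multiple of a single basis matrix, so the scalars in [E1] and [E2] can be
   compared. *)
pose scal A w := w \in G /\ exists2 s, s != 0 & A = s *: U w.
have scalU u : u \in G -> scal (U u) u.
  by split=> //; exists 1; rewrite ?oner_neq0 ?scale1r.
have scalM A B u v : scal A u -> scal B v -> scal (A *m B) (u * v)%g.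
  move=> [Gu [s s0 ->]] [Gv [t t0 ->]]; split; first exact: groupM.
  exists (s * t * f u v); first by rewrite !mulf_neq0 ?fnz.
  by rewrite -scalemxAl -scalemxAr UM // !scalerA.
have [w [Gw [s s0 ME]]] : exists w, scal M w.
  by eexists; rewrite /M; repeat first [eapply scalM | eapply scalU].
move: E1; rewrite E2 ME !scalerA => /(twisted_mx_scaler_inj Hf Gw) /(mulIf s0) E.
apply: (mulfI (_ : a * g * b != 0)); first by rewrite !mulf_neq0.
have -> : a * g * b * (theta f c z * theta f d x) = a * theta f c z * g * b * theta f d x by ring.
by rewrite -E; ring.
Qed.

End Hexagon.

(** * Orders of Schur multipliers of p-groups *)

Section SchurOrder.
Local Open Scope group_scope.

Definition schur_card (gT : finGroupType) (G : {set gT}) m :=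
  nclass (is_2cocycle G) (cohomologous G) m.

Lemma schur_order_card (gT : finGroupType) (G : {set gT}) m : schur_order G m -> schur_card G m.
Proof.
move=> [s [_ [sZ [sR Zs]]]].
exists 'I_m, (fun i : 'I_m => nth (fun _ _ => 1%R) s i); split=> [|i|i j|f Hf].
- exact: card_ord.
- exact: sZ.
- move=> cij; apply/eqP/negPn/negP=> /eqP ne_ij.
  by apply: (sR i j) cij => // /val_inj.
by have [i lti fi] := Zs f Hf; exists (Ordinal lti).
Qed.

Variables (gT : finGroupType) (G : {group gT}).

Lemma schur_card_cyclic : cyclic G -> schur_card G 1.
Proof.
case/cyclicP=> k defG; exists unit, (fun _ _ _ => 1%R); split=> [|_|[] []|f Hf] //.
- by rewrite card_unit.
- exact: cocycle_cst1.
exists tt; have [|c [c0 fc]] := cocycle_cycle_cobound Hf (k := k); first by rewrite defG cycle_id.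
rewrite -defG in c0 fc; exists c; split=> // x y Gx Gy.
by rewrite fc // GRing.mul1r.
Qed.

Variable k : gT.
Hypothesis Zk : k \in 'Z(G).
Let K := <[k]>%G.
Variables m m' a : nat.
Hypotheses (Gm : schur_card G m) (Qm' : schur_card (G / K) m')
  (Ga : nclass (is_2cocycle G) (theta_eq G k) a).

Let nclass_eqs : exists b c, [/\ nclass (@inflate_trivial gT G k) (cohomologous (G / K)) c,
  m = (a * b)%N & m' = (b * c)%N].
Proof.
have [m2 [a2 [b [c [Gm2 Ga2 Qc Em Em']]]]] := (central_step Zk Qm').
exists b, c; split=> //.
rewrite (nclass_uniq (theta_eq_equiv G k) Ga Ga2) -Em.
exact: nclass_uniq (cohomologous_equiv G) Gm Gm2.
Qed.

(** With [m = a * b] and [m' = b * c], all depends on the order [c] of the kernel of inflation: here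
    [0 < c] suffices, while the next two lemmas have [c = #[k]] and [c = 1]. *)
Lemma schur_card_leq : (m <= m' * a)%N.
Proof.
have [b [c [Qc -> ->]]] := nclass_eqs.
have c_gt0 : (0 < c)%N.
  have [I [s [<- _ _ sZ]]] := Qc.
  have [|i _] := sZ (fun _ _ => 1%R); last by apply/card_gt0P; exists i.
  by split; [apply: cocycle_cst1 | apply: coh_eq_in].
by rewrite mulnC leq_mul // leq_pmulr.
Qed.

Lemma schur_card_der1 : k \in G^`(1) -> (m * #[k] = m' * a)%N.
Proof.
move=> G'k; have [b [c [Qc -> ->]]] := nclass_eqs.
rewrite (nclass_uniq (cohomologous_equiv _) Qc (inflate_trivial_der1 Zk G'k)).
by rewrite -mulnA mulnC.
Qed.

Lemma schur_card_compl (H : {group gT}) : K :&: H = 1 -> K * H = G -> (m = m' * a)%N.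
Proof.
move=> tiKH defG; have [b [c [Qc -> ->]]] := nclass_eqs.
rewrite (nclass_uniq (cohomologous_equiv _) Qc (inflate_trivial_compl Zk tiKH defG)).
by rewrite muln1 mulnC.
Qed.

End SchurOrder.

(** * Multipliers of p-groups and first bounds on theta *)

Section PGroups.
Local Open Scope group_scope.
Variable p : nat.
Hypothesis p_pr : prime p.

Lemma schur_card_exists (gT : finGroupType) (G : {group gT}) :
  p.-group G -> exists m, schur_card G m.
Proof.
have [n] := ubnP #|G|; elim: n => // n IH in gT G * => leGn pG.
have [/eqP G1 | ntG] := boolP (G :==: 1).
  by exists 1%N; apply: schur_card_cyclic; rewrite G1 cyclic1.
have ntZ : 'Z(G) != 1 by rewrite center_nil_eq1 ?(pgroup_nil pG).
have [_ pZ _] := pgroup_pdiv (pgroupS (center_sub G) pG) ntZ.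
have [k Zk ok] := Cauchy p_pr pZ.
have sKG : <[k]> \subset G by rewrite cycle_subG (subsetP (center_sub G)).
have [|m' Qm'] := IH _ (G / <[k]>)%G _ (quotient_pgroup _ pG).
  move: leGn; rewrite ltnS; apply: leq_trans; rewrite ltn_quotient // -cardG_gt1.
  by rewrite -orderE ok prime_gt1.
have [m [a [b [c [Gm _ _ _ _]]]]] := (central_step Zk Qm').
by exists m.
Qed.

Section ThetaBounds.
Variables (gT : finGroupType) (G : {group gT}) (k : gT) (a : nat).
Hypotheses (pG : p.-group G) (Zk : k \in 'Z(G)) (ok : #[k] = p)
  (Ga : nclass (is_2cocycle G) (theta_eq G k) a).

Lemma theta_Phi f x : is_2cocycle G f -> x \in 'Phi(G) -> theta f k x = 1%R.
Proof.
move=> Hf; rewrite (Phi_joing pG); apply: (theta_ker_gen Hf Zk).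
  by rewrite subUset der_sub Mho_sub.
move=> y /setUP[/(theta_der1 Hf Zk) //|]; rewrite (MhoE _ pG).
apply: (theta_ker_gen Hf Zk) => [|_ /imsetP[z Gz ->]].
  by apply/subsetP=> _ /imsetP[z Gz ->]; rewrite groupX.
by rewrite (theta_expr Hf) // expn1 -ok (theta_unity Hf).
Qed.

Lemma theta_count_leq_card : (a * p <= #|G|)%N.
Proof.
have sKG : <[k]> \subset G by rewrite cycle_subG (subsetP (center_sub G)).
rewrite -[X in (_ * X <= _)%N]ok orderE -[leqRHS]mul1n -(expn0 p).
apply: (theta_count_leq (S0 := [::]) pG Zk ok Ga sKG) => // f Hf _ x.
exact: (theta_cycle Hf Zk).
Qed.

(** [theta f k] kills [<[k]>] and the Frattini subgroup. The latter is not contained in [<[k]>] when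
    the quotient is not elementary abelian, so the common kernel has order at least [p ^ 2]. *)
Lemma theta_count_leq_nonabelem : ~~ p.-abelem (G / <[k]>) -> (a * p ^ 2 <= #|G|)%N.
Proof.
have sKG : <[k]> \subset G by rewrite cycle_subG (subsetP (center_sub G)).
have nKG : G \subset 'N(<[k]>).
  by apply: subset_trans (cent_sub _); rewrite centsC cycle_subG; case/setIP: Zk.
rewrite -(trivg_Phi (quotient_pgroup _ pG)) -(quotient_Phi pG) // => ntPhi.
pose H := (<[k]> <*> 'Phi(G))%G.
have sHG : H \subset G by rewrite join_subG sKG Phi_sub.
have leH : (p ^ 2 <= #|H|)%N.
  rewrite expnS expn1 -{2}ok orderE; apply: pgroup_proper_card (pgroupS sHG pG) _.
  rewrite properE joing_subl join_subG subxx /=; apply: contra ntPhi => sPK.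
  by rewrite -subG1 -(trivg_quotient <[k]>%G) quotientS.
apply: leq_trans (leq_mul (leqnn a) leH) _.
rewrite -[leqRHS]mul1n -(expn0 p).
apply: (theta_count_leq (S0 := [::]) pG Zk ok Ga sHG) => // f Hf _.
apply: (theta_ker_gen Hf Zk) => [|x /setUP[|]]; first by rewrite subUset sKG Phi_sub.
  exact: (theta_cycle Hf Zk).
exact: (theta_Phi Hf).
Qed.

End ThetaBounds.
End PGroups.

Lemma nonabelian_commg (gT : finGroupType) (G : {group gT}) : ~~ abelian G ->
  exists2 x, x \in G & exists2 y, y \in G & [~ x, y]%g != 1%g.
Proof.
move=> nabG; apply: contrapT => no; case/negP: nabG; apply/centsP => x Gx y Gy.
apply/commgP/negPn/negP => ntxy; apply: no.
by exists x => //; exists y.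
Qed.

(** * The interplay of theta with commutators and p-th powers *)

Section ThetaStructure.
Local Open Scope group_scope.
Variables (p : nat) (gT : finGroupType) (G : {group gT}) (k : gT).
Hypotheses (p_pr : prime p) (pG : p.-group G) (Zk : k \in 'Z(G)) (ok : #[k] = p).
Let K := <[k]>.
Let sKZ : K \subset 'Z(G). Proof. by rewrite cycle_subG. Qed.
Let sKG : K \subset G. Proof. exact: subset_trans sKZ (center_sub G). Qed.
Let nKG : G \subset 'N(K).
Proof. by apply: subset_trans (cent_sub _); rewrite centsC; apply: subset_trans sKZ (subsetIr _ _). Qed.

Lemma theta_generator f u x : is_2cocycle G f -> u \in K -> u != 1 -> x \in G ->
  theta f u x = 1%R -> theta f k x = 1%R.
Proof.
move=> Hf Ku ntu Gx tu.
have prK : prime #|K| by rewrite -orderE ok.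
have : K \subset <[u]>.
  apply: prime_meetG prK _; apply/trivgPn; exists u => //.
  by rewrite inE Ku cycle_id.
rewrite cycle_subG => /cycleP[j ->].
by rewrite (theta_expl Hf) ?tu ?GRing.expr1n // (subsetP sKZ).
Qed.

Lemma theta_in_cycle f u x : is_2cocycle G f -> u \in K -> x \in G ->
  theta f k x = 1%R -> theta f u x = 1%R.
Proof. by move=> Hf /cycleP[i ->] Gx tx; rewrite (theta_expl Hf) // tx GRing.expr1n. Qed.

(** The side conditions of [theta_hexagon] hold because [theta] is trivial between elements of
    [K]. *)
Lemma theta_commutators f x y z : is_2cocycle G f -> x \in G -> y \in G -> z \in G ->
    [~ x, y] \in K -> [~ y, z] \in K -> [~ x, z] \in K ->
  (theta f [~ x, y] z * theta f [~ y, z] x)%R = theta f [~ x, z] y.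
Proof.
move=> Hf Gx Gy Gz Kxy Kyz Kxz.
have tK u v : u \in K -> v \in K -> theta f u v = 1%R.
  move=> Ku Kv; apply: theta_in_cycle => //; first exact: (subsetP sKG).
  exact: (theta_cycle Hf Zk).
have zK := subsetP sKZ.
exact: (theta_hexagon Hf Gx Gy Gz (zK _ Kxy) (zK _ Kyz) (zK _ Kxz)
  (tK _ _ Kxy Kyz) (tK _ _ Kxy Kxz) (tK _ _ Kyz Kxz) (commgC _ _) (commgC _ _) (commgC _ _)).
Qed.

(** In the commutator relation only the factor [theta f [~ x, y] z] survives, and [[~ x, y]]
    generates [K]. Only three commutators are required to lie in [K], so this also serves when
    [G / K] is not abelian. *)
Lemma theta_commutators_trivial f x y z : is_2cocycle G f -> x \in G -> y \in G -> z \in G ->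
    [~ x, y] \in K -> [~ y, z] \in K -> [~ x, z] \in K -> [~ x, y] != 1 ->
    theta f k x = 1%R -> theta f k y = 1%R ->
  theta f k z = 1%R.
Proof.
move=> Hf Gx Gy Gz Kxy Kyz Kxz ntxy tx ty.
apply: (theta_generator Hf Kxy) => //.
have := theta_commutators Hf Gx Gy Gz Kxy Kyz Kxz.
by rewrite (theta_in_cycle Hf Kyz) // (theta_in_cycle Hf Kxz) // GRing.mulr1.
Qed.

Lemma theta_nontrivial a : nclass (is_2cocycle G) (theta_eq G k) a -> (1 < a)%N ->
  exists f, is_2cocycle G f /\ exists2 g, g \in G & theta f k g <> 1%R.
Proof.
move=> Ga a_gt1; apply: contrapT => nof.
suff : (a <= #[k] ^ size (@nil gT))%N by rewrite leqNgt a_gt1.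
apply: (nclass_theta_leq Zk Ga) => // f Hf _ x Gx.
by apply: contrapT => tx; apply: nof; exists f; split=> //; exists x.
Qed.

Section AbelemQuotient.
Hypotheses (abQ : p.-abelem (G / K)).

Lemma commg_in_cycle x y : x \in G -> y \in G -> [~ x, y] \in K.
Proof.
move=> Gx Gy; apply: subsetP (der1_min nKG (abelem_abelian abQ)) _ _.
exact: mem_commg.
Qed.

Lemma expg_in_cycle x : x \in G -> x ^+ p \in K.
Proof.
move=> Gx; have nx := subsetP nKG x Gx.
have [_ eQ] := abelemP p_pr abQ.
by apply: coset_idr; rewrite ?groupX // morphX // eQ ?mem_quotient.
Qed.

Lemma theta_expg_nontrivial f x : is_2cocycle G f -> x \in G -> x ^+ p != 1 ->
  theta f k x = 1%R.
Proof.
move=> Hf Gx ntx; apply: (theta_generator Hf (expg_in_cycle Gx)) => //.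
exact: (theta_expg_self Hf).
Qed.

Section Count.
Variable a : nat.
Hypothesis (Ga : nclass (is_2cocycle G) (theta_eq G k) a).

Lemma theta_count_abelem_quotient : ~~ abelian G -> (a <= p ^ 2)%N.
Proof.
move=> nabG; have [x Gx [y Gy ntxy]] := nonabelian_commg nabG.
rewrite -ok; apply: (nclass_theta_leq (S := [:: x; y]) Zk Ga) => [z|f Hf txy z Gz].
  by rewrite !inE => /orP[]/eqP->.
have tx : theta f k x = 1%R by rewrite txy ?mem_head.
have ty : theta f k y = 1%R by rewrite txy // !inE eqxx orbT.
exact: (theta_commutators_trivial Hf Gx Gy Gz (commg_in_cycle Gx Gy) (commg_in_cycle Gy Gz)
  (commg_in_cycle Gx Gz) ntxy tx ty).
Qed.

(** A noncommuting pair can be chosen with [x ^+ 2 != 1]. There [theta] is automatically trivial at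
    [x], so the value at [y] alone determines it. *)
Lemma theta_count_abelem_quotient2 : p = 2 -> ~~ abelian G -> (a <= 2)%N.
Proof.
move=> p2 nabG.
have [x Gx [y Gy [ntxy ntx2]]] : exists2 x, x \in G & exists2 y, y \in G &
    [~ x, y] != 1 /\ x ^+ 2 != 1.
  have [x Gx [y Gy ntxy]] := nonabelian_commg nabG.
  have [x2 | ntx] := eqVneq (x ^+ 2) 1; last by exists x => //; exists y.
  have [y2 | nty] := eqVneq (y ^+ 2) 1.
    (* Both squares are trivial, so [x * y] cannot square to [1]: being its own inverse it would
       force [x] and [y] to commute. *)
    exists (x * y); first exact: groupM.
    exists y => //; rewrite commMgJ commgg mulg1 conjg_eq1 ntxy; split=> //.
    apply: contra ntxy => /eqP xy2; apply/commgP; rewrite /commute.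
    have inv (u : gT) : u ^+ 2 = 1 -> u = u^-1.
      by move=> u2; apply: (mulgI u); rewrite mulgV -u2 expgS expg1.
    by rewrite (inv _ xy2) invMg -(inv _ x2) -(inv _ y2).
  by exists y => //; exists x => //; rewrite -invg_comm invg_eq1.
rewrite -[2]expn1 -p2 -ok.
apply: (nclass_theta_leq (S := [:: y]) Zk Ga) => [z|f Hf ty' z Gz].
  by rewrite inE => /eqP->.
have ty : theta f k y = 1%R by rewrite ty' ?mem_head.
have tx : theta f k x = 1%R by apply: theta_expg_nontrivial; rewrite ?p2.
exact: (theta_commutators_trivial Hf Gx Gy Gz (commg_in_cycle Gx Gy) (commg_in_cycle Gy Gz)
  (commg_in_cycle Gx Gz) ntxy tx ty).
Qed.

End Count.

Section NontrivialTheta.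
Variable f : gT -> gT -> algC.
Hypotheses (Hf : is_2cocycle G f) (tf : exists2 g, g \in G & theta f k g <> 1%R)
  (nabG : ~~ abelian G).

Lemma theta_center w : w \in 'Z(G) -> theta f k w = 1%R.
Proof.
case/centerP=> Gw wC; have [x Gx [y Gy ntxy]] := nonabelian_commg nabG.
have cw u : u \in G -> [~ u, w] = 1 by move=> Gu; apply/eqP/commgP/esym/wC.
apply: (theta_generator Hf (commg_in_cycle Gx Gy) ntxy Gw).
have := theta_commutators Hf Gx Gy Gw
    (commg_in_cycle Gx Gy) (commg_in_cycle Gy Gw) (commg_in_cycle Gx Gw).
by rewrite !cw // !(theta1l Hf) // GRing.mulr1.
Qed.

Lemma theta_nontrivial_pair : exists x y, [/\ x \in G, y \in G, [~ x, y] != 1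
  & theta f k y <> 1%R].
Proof.
have [x Gx [y Gy ntxy]] := nonabelian_commg nabG.
have [ty | nty] := pselect (theta f k y = 1%R); last by exists x, y.
exists y, x; split=> //; first by rewrite -invg_comm invg_eq1.
move=> tx; have [z Gz tz] := tf; apply: tz.
exact: (theta_commutators_trivial Hf Gx Gy Gz (commg_in_cycle Gx Gy) (commg_in_cycle Gy Gz)
  (commg_in_cycle Gx Gz) ntxy tx ty).
Qed.

(** An element [w] commuting with [x] and [y] has [theta f k w = 1]. If it did not commute with some
    [u], the relation for [u], [w], [y] would force [theta f k y = 1]. *)
Lemma center_of_pair x y : x \in G -> y \in G -> [~ x, y] != 1 -> theta f k y <> 1%R ->
  'C_G[x] :&: 'C_G[y] \subset 'Z(G).
Proof.
move=> Gx Gy ntxy ty; apply/subsetP=> w /setIP[/setIP[Gw /cent1P xw] /setIP[_ /cent1P yw]].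
have tw : theta f k w = 1%R.
  apply: (theta_generator Hf (commg_in_cycle Gx Gy) ntxy Gw).
  have := theta_commutators Hf Gx Gy Gw
    (commg_in_cycle Gx Gy) (commg_in_cycle Gy Gw) (commg_in_cycle Gx Gw).
  have -> : [~ x, w] = 1 by apply/eqP/commgP.
  have -> : [~ y, w] = 1 by apply/eqP/commgP.
  by rewrite !(theta1l Hf) // GRing.mulr1.
apply/centerP; split=> // u Gu; apply/esym/commgP/negPn/negP => ntuw; apply: ty.
apply: (theta_generator Hf (commg_in_cycle Gu Gw) ntuw Gy).
have := theta_commutators Hf Gu Gw Gy
    (commg_in_cycle Gu Gw) (commg_in_cycle Gw Gy) (commg_in_cycle Gu Gy).
have -> : [~ w, y] = 1 by apply/eqP/commgP.
by rewrite (theta1l Hf) // GRing.mulr1 => ->; apply: (theta_in_cycle Hf) => //; apply: commg_in_cycle.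
Qed.

Lemma card_cent1_leq x : x \in G -> (#|G| <= p * #|'C_G[x]|)%N.
Proof.
move=> Gx; rewrite -(Lagrange (subsetIl G 'C[x])) mulnC leq_mul2r index_cent1.
apply/orP; right; rewrite -ok orderE -(card_lcoset <[k]> x) subset_leq_card //.
apply/subsetP=> _ /imsetP[y Gy ->]; apply/lcosetP; exists [~ x, y]; first exact: commg_in_cycle.
by rewrite commgEl mulKVg.
Qed.

(** Conjugates of an element differ by [K], so two centralizers of index at most [p] meet inside the
    centre. An index below [p ^ 2] would make [G / 'Z(G)] cyclic and [G] abelian. *)
Lemma card_center_theta : (#|G| = p ^ 2 * #|'Z(G)|)%N.
Proof.
have [x [y [Gx Gy ntxy ty]]] := theta_nontrivial_pair.
apply/anti_leq/andP; split.
  have leZ := subset_leq_card (center_of_pair Gx Gy ntxy ty).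
  have C1C2 := mul_cardG 'C_G[x] 'C_G[y].
  have leM : (#|('C_G[x] * 'C_G[y])%g| <= #|G|)%N.
    by rewrite subset_leq_card // mul_subG ?subsetIl.
  have := leq_mul (card_cent1_leq Gx) (card_cent1_leq Gy).
  rewrite mulnACA C1C2 mulnCA => le1.
  have G0 := cardG_gt0 G.
  rewrite -(leq_pmul2l G0); apply: leq_trans le1 _.
  by apply: leq_mul => //; apply: leq_mul.
rewrite -(Lagrange (center_sub G)) mulnC leq_mul2l.
apply/orP; right; rewrite -card_quotient ?(char_norm (center_char G)) ?gFnorm //.
have pQ : p.-group (G / 'Z(G)) by apply: quotient_pgroup.
rewrite leqNgt (card_pgroup pQ) ltn_exp2l ?prime_gt1 //; apply: contra nabG => ltQ.
apply: cyclic_center_factor_abelian; move: ltQ; case E: (logn _ _) => [|[|//]] _.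
  by rewrite (card1_trivg (_ : #|G / 'Z(G)| = 1%N)) ?cyclic1 // (card_pgroup pQ) E.
by rewrite prime_cyclic // (card_pgroup pQ) E.
Qed.

(** Elements with nontrivial [theta] have trivial [p]-th power. Any other [g] is handled by
    multiplying it by such an [x]: the correction [[~ x, g] ^+ 'C(p, 2)] vanishes for odd [p]. *)
Lemma exponent_theta : odd p -> exponent G %| p.
Proof.
move=> oddp; apply/exponentP=> g Gg.
have tp u : u \in G -> theta f k u <> 1%R -> u ^+ p = 1.
  by move=> Gu tu; apply/eqP/negPn/negP => /(theta_expg_nontrivial Hf Gu).
have [x Gx tx] := tf.
have [tg | /tp->//] := pselect (theta f k g = 1%R).
have xp := tp x Gx tx.
have tgx : theta f k (g * x) <> 1%R by rewrite (theta_mulr Hf) // tg GRing.mul1r.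
have := tp _ (groupM Gg Gx) tgx.
have Kc := commg_in_cycle Gx Gg.
have cK u : u \in G -> commute u [~ x, g].
  by move=> Gu; have /centerP[_ cc] := subsetP sKZ _ Kc; apply/esym/cc.
rewrite expMg_Rmul; [|exact: cK|exact: cK].
rewrite xp mulg1 bin2odd // expgM (_ : [~ x, g] ^+ p = 1) ?expg1n ?mulg1 //.
by case/cycleP: Kc => i ->; rewrite -expgM mulnC expgM -ok expg_order expg1n.
Qed.

End NontrivialTheta.
End AbelemQuotient.
End ThetaStructure.

(** * Multipliers of elementary abelian groups, and bounds for other p-groups *)

Section Elementary.
Local Open Scope group_scope.
Variable p : nat.
Hypothesis p_pr : prime p.

Lemma theta_count_geq_compl (gT : finGroupType) (G H : {group gT}) (k : gT) a :
    k \in 'Z(G) -> #[k] = p -> <[k]> \x H = G -> p.-abelem H ->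
    nclass (is_2cocycle G) (theta_eq G k) a ->
  (#|H| <= a)%N.
Proof.
move=> Zk ok defG abH Ga; have cHH := abelem_abelian abH.
have [_ defKH cKH tiKH] := dprodP defG.
have sHG : H \subset G by rewrite -defKH mulG_subr.
have sKG : <[k]> \subset G by rewrite -defKH mulG_subl.
have Gk : k \in G by rewrite -cycle_subG.
have uniq i j h h' : h \in H -> h' \in H -> k ^+ i * h = k ^+ j * h' ->
    (i = j %[mod p])%N /\ h = h'.
  move=> Hh Hh' eqkh.
  have Gx : k ^+ i * h \in G by rewrite -defKH mem_mulg ?mem_cycle.
  have [y [z [_ _ _ yz]]] := mem_dprod defG Gx.
  have [ei eh] := yz _ _ (mem_cycle k i) Hh erefl.
  have [ej eh'] := yz _ _ (mem_cycle k j) Hh' eqkh.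
  split; last by rewrite eh.
  by apply/eqP; rewrite -ok -eq_expg_mod_order ei ej.
have /choice[dec decP] x : exists ih : nat * gT, x \in G -> ih.2 \in H /\ x = k ^+ ih.1 * ih.2.
  have [|_] := boolP (x \in G); last by exists (0%N, 1).
  by rewrite -defKH => /mulsgP[_ h /cycleP[i ->] Hh ->]; exists (i, h).
have decM x y : x \in G -> y \in G ->
    ((dec (x * y)%g).1 = (dec x).1 + (dec y).1 %[mod p])%N /\ (dec (x * y)).2 = (dec x).2 * (dec y).2.
  move=> Gx Gy; have [Hx ex] := decP x Gx; have [Hy ey] := decP y Gy.
  have [Hxy exy] := decP _ (groupM Gx Gy).
  apply: uniq; rewrite ?groupM // -exy {1}ex {1}ey expgD -!mulgA; congr (_ * _).
  rewrite !mulgA; congr (_ * _); apply: (centsP cKH) => //.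
  by rewrite mem_cycle.
(* [F i] is bilinear: it pairs the exponent of [k] in [x] with the [H]-component of [y] through
   ['chi_i]. Its character [theta] restricts to ['chi_i] on [H]. *)
pose F (i : Iirr H) x y : algC := ('chi_i (dec y).2 ^+ (dec x).1)%R.
have lin i : ('chi[H]_i)%R \is a linear_char by apply/char_abelianP.
have chip i h : h \in H -> ('chi[H]_i h ^+ p = 1)%R.
  by move=> Hh; rewrite -lin_charX // (abelemP p_pr abH).2 // lin_char1.
have chimod i h m n : h \in H -> (m = n %[mod p])%N -> ('chi[H]_i h ^+ m = 'chi[H]_i h ^+ n)%R.
  move=> Hh mn; rewrite (divn_eq m p) (divn_eq n p) mn !GRing.exprD !(mulnC _ p) !GRing.exprM.
  by rewrite chip // !GRing.expr1n.
have FZ i : is_2cocycle G (F i).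
  split=> [x y Gx Gy|x y z Gx Gy Gz]; rewrite /F.
    by rewrite GRing.expf_neq0 // lin_char_neq0 //; case: (decP y Gy).
  have [Hy _] := decP y Gy; have [Hz _] := decP z Gz.
  have [exy _] := decM x y Gx Gy; have [_ ->] := decM y z Gy Gz.
  rewrite (chimod _ _ _ _ Hz exy) GRing.exprD lin_charM // GRing.exprMn.
  by rewrite [RHS]GRing.mulrC [in RHS]GRing.mulrA [LHS]GRing.mulrC.
have dec1 : ((dec k).1 = 1 %[mod p])%N /\ (dec k).2 = 1.
  by have [Hk ek] := decP k Gk; apply: uniq => //; rewrite -ek expg1 mulg1.
have decH h : h \in H -> ((dec h).1 = 0 %[mod p])%N /\ (dec h).2 = h.
  move=> Hh; have [Hdh eh] := decP h (subsetP sHG h Hh); apply: uniq => //.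
  by rewrite -eh expg0 mul1g.
rewrite -(card_Iirr_abelian cHH).
apply: (nclass_theta_geq (F := F) Ga FZ) => i j eqF; apply: irr_inj; apply/cfun_inP => h Hh.
have := eqF h (subsetP sHG h Hh); rewrite /theta /F.
have [e1 ->] := decH h Hh; have [e2 ->] := dec1.
by rewrite !lin_char1 // !GRing.expr1n !GRing.divr1 !(chimod _ _ _ _ Hh e2).
Qed.

Lemma cycle_central_normal (gT : finGroupType) (G : {group gT}) (k : gT) :
  k \in 'Z(G) -> <[k]> <| G.
Proof.
move=> Zk; rewrite /normal cycle_subG (subsetP (center_sub G)) //=.
by apply: subset_trans (cent_sub _); rewrite centsC cycle_subG; case/setIP: Zk.
Qed.

Lemma card_quotient_prime (gT : finGroupType) (G : {group gT}) (k : gT) n :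
  k \in 'Z(G) -> #[k] = p -> #|G| = (p ^ n)%N ->
  (0 < n)%N /\ #|G / <[k]>| = (p ^ n.-1)%N.
Proof.
move=> Zk ok oG; have p_gt0 := prime_gt0 p_pr.
have /andP[sKG nKG] := cycle_central_normal Zk.
have := LagrangeI G <[k]>; rewrite (setIidPr sKG) -card_quotient // -orderE ok oG.
case: n oG => [oG | n oG].
  by move/eqP; rewrite expn0 muln_eq1 gtn_eqF ?prime_gt1.
by rewrite expnS => /eqP; rewrite eqn_pmul2l // => /eqP.
Qed.

(** Splitting off a factor of order [p] multiplies the multiplier by the number [p ^ n] of
    characters of the complement, in step with ['C(n.+1, 2) = 'C(n, 2) + n]. *)
Lemma schur_card_abelem n (gT : finGroupType) (G : {group gT}) :
  p.-abelem G -> #|G| = (p ^ n)%N -> schur_card G (p ^ 'C(n, 2)).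
Proof.
elim: n gT G => [|n IH] gT G abG oG.
  by rewrite bin0n expn0; apply: schur_card_cyclic; rewrite (card1_trivg oG) cyclic1.
have cGG := abelem_abelian abG; have pG := abelem_pgroup abG.
have ntG : G :!=: 1 by rewrite -cardG_gt1 oG -(exp1n n.+1) ltn_exp2r // prime_gt1.
have [k Gk ntk] := trivgPn _ ntG; have ok := abelem_order_p abG Gk ntk.
have Zk : k \in 'Z(G) by rewrite (center_idP cGG).
have [H [sHG _ defG]] := p_abelem_split1 abG Gk.
have [_ defKH _ tiKH] := dprodP defG.
have [_ oQ] := card_quotient_prime Zk ok oG.
have oH : #|H| = (p ^ n)%N.
  apply/eqP; rewrite -(eqn_pmul2l (prime_gt0 p_pr)) -expnS -oG -{1}ok orderE.
  by rewrite -(TI_cardMg tiKH) defKH.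
have Qm' := IH _ (G / <[k]>)%G (quotient_abelem _ abG) oQ.
have [m Gm] := schur_card_exists p_pr pG.
have [a Ga] := nclass_theta Zk.
suff <- : m = (p ^ 'C(n.+1, 2))%N by [].
rewrite (schur_card_compl Zk Gm Qm' Ga tiKH defKH) binS bin1 expnD; congr (_ * _)%N.
apply/anti_leq/andP; split; last first.
  by rewrite -oH; apply: theta_count_geq_compl Ga => //; apply: abelemS abG.
have := theta_count_leq_card pG Zk ok Ga.
by rewrite oG expnSr leq_pmul2r ?prime_gt0.
Qed.

(** Induction through a quotient by a subgroup of order [p] that is again not elementary abelian,
    down to cyclic groups. *)
Lemma schur_card_abelian_leq n (gT : finGroupType) (G : {group gT}) m :
    p.-group G -> abelian G -> ~~ p.-abelem G -> #|G| = (p ^ n)%N -> schur_card G m ->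
  (m <= p ^ 'C(n.-1, 2))%N.
Proof.
elim: n gT G m => [|n IH] gT G m pG cGG nabG oG Gm.
  by case/negP: nabG; rewrite (card1_trivg oG) abelem1.
have [cycG | ncycG] := boolP (cyclic G).
  rewrite (nclass_uniq (cohomologous_equiv G) Gm (schur_card_cyclic cycG)).
  by rewrite expn_gt0 prime_gt0.
have [g Gg ntg] : exists2 g, g \in G & g ^+ p != 1.
  move: nabG; rewrite abelemE // cGG /= => /exponentP nexp; apply: contrapT => no.
  apply: nexp => x Gx; apply/eqP/negPn/negP => ntx; apply: no.
  by exists x.
(* A subgroup of rank 2 does not fit into the cyclic group [<[g ^+ p]>]. An element [k] of it
   outside that group keeps [g ^+ p] nontrivial modulo [<[k]>]. *)
have [E /pnElemP[sEG abE rE]] : exists E : {group gT}, E \in 'E_p^2(G).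
  by apply/p_rank_geP; rewrite -(rank_pgroup pG) ltnNge -abelian_rank1_cyclic.
have [k Ek ngk] : exists2 k, k \in E & k \notin <[g ^+ p]>.
  apply/subsetPn; apply/negP => /cyclicS/(_ (cycle_cyclic _)).
  by rewrite (abelem_cyclic abE) rE.
have ntk : k != 1 by apply: contraNneq ngk => ->; rewrite group1.
have ok := abelem_order_p abE Ek ntk; have Gk := subsetP sEG k Ek.
have Zk : k \in 'Z(G) by rewrite (center_idP cGG).
have [_ oQ] := card_quotient_prime Zk ok oG.
have ngpk : g ^+ p \notin <[k]>.
  apply: contra ngk => gpk.
  have prK : prime #|<[k]>| by rewrite -orderE ok.
  rewrite -cycle_subG; apply: prime_meetG prK _; apply/trivgPn; exists (g ^+ p) => //.
  by rewrite inE gpk cycle_id.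
have nKg : g \in 'N(<[k]>) by apply: subsetP (normal_norm (cycle_central_normal Zk)) _ Gg.
have nabQ : ~~ p.-abelem (G / <[k]>).
  apply: contra ngpk => abQ; have [_ eQ] := abelemP p_pr abQ.
  by apply: coset_idr; rewrite ?groupX // morphX // eQ ?mem_quotient.
have pQ : p.-group (G / <[k]>) := quotient_pgroup _ pG.
have [m' Qm'] := schur_card_exists p_pr pQ.
have [a Ga] := nclass_theta Zk.
have le_m := schur_card_leq Zk Gm Qm' Ga.
have le_m' := IH _ _ _ pQ (quotient_abelian _ cGG) nabQ oQ Qm'.
have le_a := theta_count_leq_nonabelem pG Zk ok Ga nabQ.
apply: leq_trans le_m (leq_trans (leq_mul le_m' (leqnn a)) _).
case: n {IH} oG oQ le_m' le_a => [|n] oG oQ le_m' le_a.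
  by case/negP: nabQ; rewrite (card1_trivg oQ) abelem1.
rewrite /= binS bin1 expnD leq_pmul2l ?expn_gt0 ?prime_gt0 //.
by move: le_a; rewrite oG -[n.+2]addn2 expnD leq_pmul2r ?expn_gt0 ?prime_gt0.
Qed.

Lemma nonabelian_central_der1 (gT : finGroupType) (G : {group gT}) :
    p.-group G -> ~~ abelian G ->
  exists k, [/\ k \in 'Z(G), k \in G^`(1) & #[k] = p].
Proof.
move=> pG nabG; have ntG' : G^`(1) != 1 by rewrite (sameP eqP derG1P).
have ntZ : G^`(1) :&: 'Z(G) != 1 by rewrite meet_center_nil ?(pgroup_nil pG) ?der_normal.
have pZ : p.-group (G^`(1) :&: 'Z(G)) by apply: pgroupS pG; rewrite subIset // der_sub.
have [_ pdvd _] := pgroup_pdiv pZ ntZ.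
by have [k /setIP[G'k Zk] ok] := Cauchy p_pr pdvd; exists k.
Qed.

(** The extra factor [p] is due to the case of an elementary abelian quotient, where [m * p] is at
    most [p ^ 'C(n.-1, 2) * p ^ 2]. For other quotients the induction hypothesis suffices. *)
Lemma schur_card_nonabelem_leq n (gT : finGroupType) (G : {group gT}) m :
    p.-group G -> ~~ p.-abelem G -> #|G| = (p ^ n)%N -> schur_card G m ->
  (m <= p ^ ('C(n.-1, 2)).+1)%N.
Proof.
elim: n gT G m => [|n IH] gT G m pG nabG oG Gm.
  by case/negP: nabG; rewrite (card1_trivg oG) abelem1.
have [cGG | ncGG] := boolP (abelian G).
  apply: leq_trans (schur_card_abelian_leq pG cGG nabG oG Gm) _.
  by rewrite leq_exp2l ?prime_gt1.
have [k [Zk G'k ok]] := nonabelian_central_der1 pG ncGG.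
have [_ oQ] := card_quotient_prime Zk ok oG.
have pQ : p.-group (G / <[k]>) := quotient_pgroup _ pG.
have [m' Qm'] := schur_card_exists p_pr pQ.
have [a Ga] := nclass_theta Zk.
have em := schur_card_der1 Zk Gm Qm' Ga G'k; rewrite ok in em.
have p_gt0 := prime_gt0 p_pr.
have [abQ | nabQ] := boolP (p.-abelem (G / <[k]>)).
  have le_a := theta_count_abelem_quotient p_pr Zk ok abQ Ga ncGG.
  have em' := nclass_uniq (cohomologous_equiv _) Qm' (schur_card_abelem abQ oQ).
  rewrite -(leq_pmul2r p_gt0) em em' expnSr -mulnA mulnn.
  by rewrite leq_mul.
have le_m' := IH _ _ _ pQ nabQ oQ Qm'.
have le_a := theta_count_leq_nonabelem pG Zk ok Ga nabQ.
case: n {IH} oG oQ le_m' le_a => [|n] oG oQ le_m' le_a.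
  by case/negP: nabQ; rewrite (card1_trivg oQ) abelem1.
rewrite -(leq_pmul2r p_gt0) em; apply: leq_trans (leq_mul le_m' (leqnn a)) _.
rewrite oG -[n.+2]addn2 expnD leq_pmul2r ?expn_gt0 ?p_gt0 // in le_a.
apply: leq_trans (leq_mul (leqnn _) le_a) _.
by rewrite /= -expnD -expnSr leq_exp2l ?prime_gt1 // binS bin1 addSn; apply: leqW.
Qed.

End Elementary.

(** * A cocycle for odd p *)

Section SemidirectCocycle.
Local Open Scope group_scope.
Import GRing.Theory.

Lemma bin2D i j : 'C(i + j, 2) = ('C(i, 2) + 'C(j, 2) + i * j)%N.
Proof.
elim: i => [|i IH]; first by rewrite add0n bin0n add0n mul0n addn0.
by rewrite addSn !binS !bin1 IH mulSn; lia.
Qed.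

(** [p] divides ['C(p, 2)] for odd [p], so ['C(i, 2)] modulo [p] depends on [i] modulo [p] only. *)
Lemma exp_bin2_mod (R : comNzRingType) (c : R) p i j : odd p -> (c ^+ p = 1)%R ->
  (i = j %[mod p])%N -> (c ^+ 'C(i, 2) = c ^+ 'C(j, 2))%R.
Proof.
move=> oddp cp; have step l : (c ^+ 'C(l + p, 2) = c ^+ 'C(l, 2))%R.
  by rewrite bin2D !exprD (bin2odd oddp) (mulnC l p) !exprM cp !expr1n !mulr1.
have red l : (c ^+ 'C(l, 2) = c ^+ 'C(l %% p, 2))%R.
  rewrite {1}(divn_eq l p); elim: (l %/ p)%N => [|q IH]; first by rewrite mul0n.
  by rewrite mulSnr addnAC step.
by move=> ij; rewrite red ij -red.
Qed.

Lemma prim_root_of_unity_neq1 (z : algC) p : prime p -> (z ^+ p = 1)%R -> (z <> 1)%R ->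
  (p.-primitive_root z)%R.
Proof.
move=> p_pr zp z1; have [m mz dvm] := prim_order_exists (prime_gt0 p_pr) zp.
have /primeP[_ /(_ m dvm)/pred2P[m1 | <- //]] := p_pr; case: z1.
by have := prim_expr_order mz; rewrite m1 expr1.
Qed.

Variables (p : nat) (gT : finGroupType) (G A : {group gT}) (k y : gT).
Hypotheses (p_pr : prime p) (oddp : odd p) (Zk : k \in 'Z(G)) (ok : #[k] = p)
  (eG : exponent G %| p) (cAA : abelian A) (Ak : k \in A) (oy : #[y] = p)
  (tiyA : <[y]> :&: A = 1) (defG : <[y]> * A = G)
  (Ay : forall a, a \in A -> [~ a, y] \in <[k]>).

(* The cocycle of the extension (A x mu_p) ><| <y>, in which y acts on A x mu_p by
   lifting its unipotent action on A; since p > 2 the lift again has order p. *)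
Lemma semidirect_cocycle : exists f, [/\ is_2cocycle G f,
  forall a, a \in A -> theta f k a = 1%R & theta f k y <> 1%R].
Proof.
have sAG : A \subset G by rewrite -defG mulG_subr.
have Gy : y \in G by rewrite -cycle_subG -defG mulG_subl.
have Gk : k \in G by case/centerP: Zk.
have kA : <[k]> \subset A by rewrite cycle_subG.
have kZ : <[k]> \subset 'Z(G) by rewrite cycle_subG.
have uniq i j a b : a \in A -> b \in A -> y ^+ i * a = y ^+ j * b ->
    (i = j %[mod p])%N /\ a = b.
  move=> Aa Ab E.
  have eyi : (y ^+ j)^-1 * y ^+ i = b * a^-1.
    by apply: (mulgI (y ^+ j)); apply: (mulIg a); rewrite mulKVg -!mulgA mulVg mulg1.
  have : (y ^+ j)^-1 * y ^+ i \in <[y]> :&: A.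
    by rewrite inE groupM ?groupV ?mem_cycle // eyi groupM ?groupV.
  rewrite tiyA => /set1P y1; split.
    by apply/eqP; rewrite -oy -eq_expg_mod_order eq_sym eq_mulVg1 y1.
  by apply/eqP; rewrite eq_sym eq_mulgV1 -eyi y1.
have /choice[dec decP] x : exists ia : nat * gT, x \in G -> ia.2 \in A /\ x = y ^+ ia.1 * ia.2.
  have [|_] := boolP (x \in G); last by exists (0%N, 1).
  by rewrite -defG => /mulsgP[_ a /cycleP[i ->] Aa ->]; exists (i, a).
have ayC a : a \in A -> forall u, u \in G -> commute u [~ a, y].
  by move=> Aa u Gu; have /centerP[_ cc] := subsetP kZ _ (Ay Aa); apply/esym/cc.
have conjy a j : a \in A -> a * y ^+ j = y ^+ j * (a * [~ a, y] ^+ j).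
  move=> Aa; have Ga := subsetP sAG a Aa.
  by rewrite commgC commgX //; [rewrite mulgA | apply: ayC].
have decM x z : x \in G -> z \in G ->
    ((dec (x * z)%g).1 = (dec x).1 + (dec z).1 %[mod p])%N
    /\ (dec (x * z)).2 = (dec x).2 * [~ (dec x).2, y] ^+ (dec z).1 * (dec z).2.
  move=> Gx Gz; have [Ax ex] := decP x Gx; have [Az ez] := decP z Gz.
  have [Axz exz] := decP _ (groupM Gx Gz).
  apply: uniq; rewrite ?groupM ?groupX ?(subsetP kA _ (Ay Ax)) //.
  rewrite -exz {1}ex {1}ez expgD -!mulgA; congr (_ * _).
  by rewrite (mulgA (dec x).2 (y ^+ _)) conjy // !mulgA.
(* Characters of the abelian group [A] separate its elements; one that is nontrivial at [k] will
   yield [theta f k y = chi k]. *)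
have [i chik] : exists i : Iirr A, ('chi_i k != 1)%R.
  apply: contrapT => no; have : k \in \bigcap_(i : Iirr A) cfker ('chi_i)%R.
    apply/bigcapP => i _; rewrite cfkerEirr inE lin_char1; last by apply/char_abelianP.
    by apply/negPn/negP => ck; apply: no; exists i.
  rewrite TI_cfker_irr => /set1P k1; by have := prime_gt1 p_pr; rewrite -ok k1 order1.
pose chi := ('chi_i)%R; have lin : chi \is a linear_char by apply/char_abelianP.
have chip a : a \in A -> (chi a ^+ p = 1)%R.
  by move=> Aa; rewrite -lin_charX // (exponentP eG) ?lin_char1 ?(subsetP sAG).
have chimod a m n : a \in A -> (m = n %[mod p])%N -> (chi a ^+ m = chi a ^+ n)%R.
  move=> Aa mn; rewrite (divn_eq m p) (divn_eq n p) mn !exprD !(mulnC _ p) !exprM.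
  by rewrite chip // !expr1n.
have Aay a : a \in A -> [~ a, y] \in A by move=> Aa; apply: subsetP kA _ (Ay Aa).
pose psi a := chi [~ a, y].
have psiM a b : a \in A -> b \in A -> (psi (a * b)%g = psi a * psi b)%R.
  move=> Aa Ab; have Gb := subsetP sAG b Ab; rewrite /psi commMgJ conjgE.
  by rewrite -(ayC a Aa b Gb) mulKg lin_charM ?Aay.
have psi1 a j : a \in A -> psi ([~ a, y] ^+ j) = 1%R.
  move=> Aa; rewrite /psi (_ : [~ _, y] = 1) ?lin_char1 //.
  by apply/eqP/commgP/commute_sym/commuteX/ayC.
(* [phi j a] is the product of the values of [chi] at the conjugates [a * [~ a, y] ^+ l] for
   [l < j]; the exponent ['C(j, 2)] is the sum of these [l]. *)
pose phi j a := (chi a ^+ j * psi a ^+ 'C(j, 2))%R.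
have phi0 j a : a \in A -> (phi j a != 0)%R.
  by move=> Aa; rewrite mulf_neq0 // expf_neq0 // lin_char_neq0 ?Aay.
have phimod j l a : a \in A -> (j = l %[mod p])%N -> phi j a = phi l a.
  by move=> Aa jl; rewrite /phi (chimod a j l) // (exp_bin2_mod oddp _ jl) // chip ?Aay.
exists (fun x z => phi (dec z).1 (dec x).2).
have decA a : a \in A -> ((dec a).1 = 0 %[mod p])%N /\ (dec a).2 = a.
  move=> Aa; have [Ada ea] := decP a (subsetP sAG a Aa); apply: uniq => //.
  by rewrite -ea expg0 mul1g.
have decy : ((dec y).1 = 1 %[mod p])%N /\ (dec y).2 = 1.
  by have [Ady ey] := decP y Gy; apply: uniq => //; rewrite -ey expg1 mulg1.
have phi_0 a : (phi 0%N a = 1)%R by rewrite /phi bin0n !expr0 mulr1.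
split.
- split=> [x z Gx Gz|x z w Gx Gz Gw]; first by rewrite phi0 //; case: (decP x Gx).
  have [Ax _] := decP x Gx; have [Az _] := decP z Gz.
  have [_ ->] := decM x z Gx Gz; have [ezw _] := decM z w Gz Gw.
  rewrite (phimod _ _ _ Ax ezw) /phi !psiM ?psi1 ?groupM ?groupX ?Aay //.
  rewrite !lin_charM ?groupM ?groupX ?Aay // lin_charX ?Aay // -/(psi _).
  by rewrite bin2D !exprD !exprMn !exprM ?expr1n; ring.
- move=> a Aa; have [ea1 ea2] := decA a Aa; have [ek1 ek2] := decA k Ak.
  by rewrite /theta ea2 ek2 (phimod _ _ _ Ak ea1) (phimod _ _ _ Aa ek1) !phi_0 divr1.
have [ey1 ey2] := decy; have [ek1 ek2] := decA k Ak.
rewrite /theta ek2 ey2 (phimod _ _ _ Ak ey1) (phimod _ _ _ (group1 A) ek1) phi_0 divr1.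
by rewrite /phi expr1 bin_small // mulr1; apply/eqP.
Qed.

End SemidirectCocycle.

(** * Groups with centre of index p^2, and the count of theta for odd p *)

Section CenterIndex.
Local Open Scope group_scope.
Variables (p : nat) (gT : finGroupType) (G : {group gT}).
Hypotheses (p_pr : prime p) (pG : p.-group G) (oGZ : (#|G| = p ^ 2 * #|'Z(G)|)%N).

(** The centralizer lies strictly between the centre and [G], so both steps have index [p]; it is
    abelian because it is cyclic modulo central elements. *)
Lemma cent1_index_p2 x : x \in G -> x \notin 'Z(G) ->
  abelian 'C_G[x] /\ (#|G| = p * #|'C_G[x]|)%N.
Proof.
move=> Gx nZx; have p_gt0 := prime_gt0 p_pr.
have sCG : 'C_G[x] \subset G by apply: subsetIl.
have sZC : 'Z(G) \subset 'C_G[x].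
  apply/subsetP=> z /centerP[Gz zC]; rewrite inE Gz; apply/cent1P; exact: zC.
have prCG : 'C_G[x] \proper G.
  rewrite properE sCG; apply: contra nZx => /subsetP sGC.
  apply/centerP; split=> // y Gy; have /setIP[_ /cent1P] := sGC y Gy.
  by move=> /esym.
have prZC : 'Z(G) \proper 'C_G[x].
  rewrite properE sZC; apply: contra nZx => /subsetP-> //.
  by rewrite inE Gx cent1id.
have leC := pgroup_proper_card pG prCG.
have leZ := pgroup_proper_card (pgroupS sCG pG) prZC.
have eC : #|'C_G[x]| = (p * #|'Z(G)|)%N.
  apply/anti_leq; rewrite leZ andbT.
  by rewrite -(leq_pmul2l p_gt0) mulnA mulnn -oGZ.
split; last by rewrite eC mulnA mulnn.
have sZZ : 'Z(G) \subset 'Z('C_G[x]).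
  rewrite subsetI sZC; apply: subset_trans (subsetIr _ _) _.
  exact: centS.
apply: (cyclic_factor_abelian sZZ); apply: prime_cyclic.
have nZC : 'C_G[x] \subset 'N('Z(G)) by apply: subset_trans sCG (normal_norm (center_normal G)).
by rewrite card_quotient // -divgS // eC mulnK ?cardG_gt0.
Qed.

End CenterIndex.

Section OddCount.
Local Open Scope group_scope.
Variables (p : nat) (gT : finGroupType) (G : {group gT}) (k : gT) (a : nat).
Hypotheses (p_pr : prime p) (oddp : odd p) (pG : p.-group G) (Zk : k \in 'Z(G)) (ok : #[k] = p)
  (abQ : p.-abelem (G / <[k]>)) (nabG : ~~ abelian G) (eG : exponent G %| p)
  (oGZ : (#|G| = p ^ 2 * #|'Z(G)|)%N) (Ga : nclass (is_2cocycle G) (theta_eq G k) a).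

(** [G] is the semidirect product of the abelian group ['C_G[x]], of index [p], by [<[y]>], of order
    [p], so [semidirect_cocycle] applies. *)
Lemma cocycle_cent1 x y : x \in G -> y \in G -> [~ x, y] != 1 ->
  exists f, [/\ is_2cocycle G f, theta f k x = 1%R & theta f k y <> 1%R].
Proof.
move=> Gx Gy ntxy; have Gk : k \in G by case/centerP: Zk.
have nZx : x \notin 'Z(G).
  by apply: contra ntxy => /centerP[_ xC]; apply/commgP/xC.
have [cAA oGA] := cent1_index_p2 p_pr pG oGZ Gx nZx.
have Ax : x \in 'C_G[x] by rewrite inE Gx cent1id.
have nAy : y \notin 'C_G[x] by rewrite inE Gy; apply: contra ntxy => /cent1P xy; apply/commgP.
have yp : y ^+ p = 1 by apply: (exponentP eG).
have oy : #[y] = p.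
  have dvy : #[y] %| p by rewrite order_dvdn yp.
  have /primeP[_ /(_ _ dvy)/pred2P[]] // := p_pr.
  by move=> /eqP; rewrite order_eq1 => /eqP y1; rewrite y1 group1 in nAy.
have tiyA : <[y]> :&: 'C_G[x] = 1 by rewrite prime_TIg ?cycle_subG // -orderE oy.
have defG : <[y]> * 'C_G[x] = G.
  apply/eqP; rewrite eqEcard mul_subG ?cycle_subG ?subsetIl //=.
  by rewrite TI_cardMg // -orderE oy oGA.
have [||f [Hf tfA tfy]] := semidirect_cocycle p_pr oddp Zk ok eG cAA _ oy tiyA defG.
- by rewrite inE Gk; apply/cent1P; case/centerP: Zk => _ /(_ x Gx).
- by move=> u /setIP[Gu _]; exact: (commg_in_cycle Zk abQ).
by exists f; split=> //; apply: tfA.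
Qed.

(** Exchanging [x] and [y] gives two cocycles, each with trivial [theta] at exactly one of the two
    elements. The products of their powers realise [p ^ 2] characters. *)
Lemma theta_count_geq_odd : (p ^ 2 <= a)%N.
Proof.
have Gk : k \in G by case/centerP: Zk.
have [x Gx [y Gy ntxy]] := nonabelian_commg nabG.
have [f [Hf fx fy]] := cocycle_cent1 Gx Gy ntxy.
have [|g [Hg gy gx]] := cocycle_cent1 Gy Gx; first by rewrite -invg_comm invg_eq1.
have prim h u : is_2cocycle G h -> u \in G -> theta h k u <> 1%R ->
    (p.-primitive_root (theta h k u))%R.
  by move=> Hh Gu; apply: prim_root_of_unity_neq1 => //; rewrite -ok (theta_unity Hh).
have fP := prim _ _ Hf Gy fy; have gP := prim _ _ Hg Gx gx.
have -> : (p ^ 2 = #|{: 'I_p * 'I_p}|)%N by rewrite card_prod !card_ord mulnn.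
pose F (ij : 'I_p * 'I_p) u v : algC := (f u v ^+ ij.1 * g u v ^+ ij.2)%R.
have thF ij u : theta (F ij) k u = (theta f k u ^+ ij.1 * theta g k u ^+ ij.2)%R.
  by rewrite /theta /F GRing.invfM GRing.mulrACA -!GRing.exprVn -!GRing.exprMn.
apply: (nclass_theta_geq (F := F) Ga) => [ij|[i j] [i' j'] eqF].
  by apply: cocycle_mul; apply: cocycle_exp.
have := eqF x Gx; have := eqF y Gy; rewrite !thF /= fx gy !GRing.expr1n !GRing.mulr1 !GRing.mul1r.
move=> /eqP; rewrite (eq_prim_root_expr fP) !modn_small // => /eqP/val_inj->.
by move=> /eqP; rewrite (eq_prim_root_expr gP) !modn_small // => /eqP/val_inj->.
Qed.

End OddCount.

(** * Groups of order p^6 *)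

Section RankSix.
Local Open Scope group_scope.
Variables (p : nat) (gT : finGroupType) (G : {group gT}).
Hypotheses (p_pr : prime p) (pG : p.-group G).

(** Two elements [x] and [y] generate [G] modulo the central [R], so [[~ x, y]] generates the
    derived subgroup. Its [p]-th power is [[~ x ^+ p, y]], which is trivial as [x ^+ p] is
    central. *)
Lemma der1_center_index2 (R : {group gT}) : R \subset 'Z(G) -> ~~ abelian G ->
    (#|G| <= p ^ 2 * #|R|)%N -> (forall x, x \in G -> x ^+ p \in R) ->
    G^`(1) \subset R ->
  (#|G^`(1)| <= p)%N.
Proof.
move=> sRZ nabG leGR powR sG'R; have sRG := subset_trans sRZ (center_sub G).
have nRG u : u \in G -> <[u]> \subset 'N(R).
  move=> Gu; rewrite cycle_subG; apply: subsetP Gu.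
  by apply: subset_trans (cent_sub _); rewrite centsC; apply: subset_trans sRZ (subsetIr _ _).
have nabR u : u \in G -> ~~ (G \subset <[u]> <*> R).
  move=> Gu; apply: contra nabG => sGuR; apply: (cyclic_factor_abelian sRZ).
  apply: cyclicS (quotientS R sGuR) _.
  by rewrite /= quotientYidr ?nRG // quotient_cyclic ?cycle_cyclic.
have [x Gx nxR] := subsetPn (nabR 1 (group1 G)).
have [y Gy nxRy] := subsetPn (nabR x Gx).
have zC u w : u \in R -> w \in G -> commute u w.
  by move=> Ru; have /centerP[_ uC] := subsetP sRZ u Ru; apply: uC.
pose H1 := (<[x]> <*> R)%G; pose XY := (<[x]> <*> <[y]>)%G; pose H2 := (XY <*> R)%G.
have sXYG : XY \subset G by rewrite join_subG !cycle_subG Gx.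
have sH2G : H2 \subset G by rewrite join_subG sXYG.
have xXY : x \in XY by rewrite -cycle_subG joing_subl.
have yXY : y \in XY by rewrite -cycle_subG joing_subr.
have sH12 : H1 \subset H2 by rewrite join_subG cycle_subG (subsetP (joing_subl _ _)) ?joing_subr.
have prRH1 : R \proper H1.
  rewrite properE joing_subr; apply: contra nxR => /subsetP sH1R.
  by rewrite cycle1 joing1G; apply: sH1R; rewrite -cycle_subG joing_subl.
have prH12 : H1 \proper H2.
  rewrite properE sH12; apply: contra nxRy => /subsetP-> //.
  by rewrite (subsetP (joing_subl _ _)).
have oH1 := pgroup_proper_card (pgroupS (subset_trans sH12 sH2G) pG) prRH1.
have oH2 := pgroup_proper_card (pgroupS sH2G pG) prH12.
have defG : XY * R = G.
  rewrite -norm_joinEl; last first.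
    apply: subset_trans sXYG (subset_trans _ (cent_sub _)).
    by rewrite centsC; apply: subset_trans sRZ (subsetIr _ _).
  apply/eqP; rewrite eqEcard sH2G; apply: leq_trans leGR _.
  rewrite -mulnn -mulnA; apply: leq_trans oH2.
  by rewrite leq_mul2l oH1 orbT.
have Rc : [~ x, y] \in R by rewrite (subsetP sG'R) // mem_commg.
have derXY : XY^`(1) = <[ [~ x, y] ]>.
  apply: der1_joing_cycles; apply/centP=> u XYu; apply: zC => //.
  exact: (subsetP sXYG).
have cp : [~ x, y] ^+ p = 1.
  rewrite -commXg; last by apply/commute_sym/zC.
  by apply/eqP/commgP/zC; rewrite ?powR.
have sG'c : G^`(1) \subset <[ [~ x, y] ]>.
  rewrite -derXY gen_subG; apply/subsetP=> _ /imset2P[g h Gg Gh ->].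
  move: Gg Gh; rewrite -defG => /mulsgP[u r XYu Rr ->] /mulsgP[v s XYv Rs ->].
  have [Gu Gv] := (subsetP sXYG u XYu, subsetP sXYG v XYv).
  have [Gr Gs] := (subsetP sRG r Rr, subsetP sRG s Rs).
  rewrite commMgJ (_ : [~ r, _] = 1) ?mulg1; last by apply/eqP/commgP/zC; rewrite ?groupM.
  have Gvs := groupM Gv Gs; rewrite conjgE -(zC r _ Rr (groupR Gu Gvs)) mulKg.
  rewrite commgMJ (_ : [~ u, s] = 1) ?mul1g; last by apply/eqP/commgP/commute_sym/zC.
  rewrite conjgE -(zC s _ Rs (groupR Gu Gv)) mulKg.
  exact: mem_commg.
apply: leq_trans (subset_leq_card sG'c) _; rewrite -orderE dvdn_leq ?prime_gt0 //.
by rewrite order_dvdn cp.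
Qed.

(** The general bounds miss the claim by one factor [p], so a counterexample attains them all. This
    rigidity yields a central subgroup [R] of index [p ^ 2], and then a derived subgroup too small
    for a nonabelian quotient. *)
Lemma schur_card_nonabelem_quotient k m :
    k \in 'Z(G) -> #[k] = p -> k \in G^`(1) -> #|G| = (p ^ 6)%N ->
    ~~ p.-abelem (G / <[k]>) -> schur_card G m ->
  (m < p ^ 10)%N.
Proof.
move=> Zk ok G'k oG nabQ Gm; rewrite ltnNge; apply/negP => lem.
have p_gt0 := prime_gt0 p_pr; have p_gt1 := prime_gt1 p_pr.
have nsKG := cycle_central_normal Zk; have [sKG nKG] := andP nsKG.
have Gk : k \in G by rewrite -cycle_subG.
have [_ oQ] := card_quotient_prime p_pr Zk ok oG; rewrite /= in oQ.
have pQ : p.-group (G / <[k]>) := quotient_pgroup _ pG.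
have [m' Qm'] := schur_card_exists p_pr pQ.
have [a Ga] := nclass_theta Zk.
have em := schur_card_der1 Zk Gm Qm' Ga G'k; rewrite ok in em.
have le_a : (a <= p ^ 4)%N.
  have := theta_count_leq_nonabelem pG Zk ok Ga nabQ.
  by rewrite oG -[6]/(4 + 2)%N expnD leq_pmul2r ?expn_gt0 ?p_gt0.
have le_m' : (m' <= p ^ 7)%N := schur_card_nonabelem_leq p_pr pQ nabQ oQ Qm'.
have le_ma : (p ^ 11 <= m' * a)%N by rewrite -em expnSr leq_pmul2r.
have ge_m' : (p ^ 7 <= m')%N.
  rewrite -(@leq_pmul2r (p ^ 4)) ?expn_gt0 ?p_gt0 // -expnD.
  by apply: leq_trans le_ma _; rewrite leq_mul2l le_a orbT.
have ge_a : (p ^ 4 <= a)%N.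
  rewrite -(@leq_pmul2l (p ^ 7)) ?expn_gt0 ?p_gt0 // -expnD.
  by apply: leq_trans le_ma _; rewrite leq_mul2r le_m' orbT.
have nabelQ : ~~ abelian (G / <[k]>).
  apply/negP => cQQ; have := schur_card_abelian_leq p_pr pQ cQQ nabQ oQ Qm'.
  by move/(leq_trans ge_m'); rewrite leq_exp2l.
have [k2 [Zk2 Q'k2 ok2]] := nonabelian_central_der1 p_pr pQ nabelQ.
have [_ oQ2] := card_quotient_prime p_pr Zk2 ok2 oQ; rewrite /= in oQ2.
have pQ2 : p.-group (G / <[k]> / <[k2]>) := quotient_pgroup _ pQ.
have [m2 Qm2] := schur_card_exists p_pr pQ2.
have [a2 Qa2] := nclass_theta Zk2.
have em2 := schur_card_der1 Zk2 Qm' Qm2 Qa2 Q'k2; rewrite ok2 in em2.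
have le_ma2 : (p ^ 8 <= m2 * a2)%N by rewrite -em2 expnSr leq_pmul2r.
(* If the second quotient is not elementary abelian, then [m2 * a2] is at most [p ^ 4 * p ^ 3],
   short of the required [p ^ 8]. *)
have [abQ2 | nabQ2] := boolP (p.-abelem (G / <[k]> / <[k2]>)); last first.
  have le_m2 : (m2 <= p ^ 4)%N := schur_card_nonabelem_leq p_pr pQ2 nabQ2 oQ2 Qm2.
  have le_a2 : (a2 <= p ^ 3)%N.
    have := theta_count_leq_nonabelem pQ Zk2 ok2 Qa2 nabQ2.
    by rewrite oQ -[5]/(3 + 2)%N expnD leq_pmul2r ?expn_gt0 ?p_gt0.
  have := leq_trans le_ma2 (leq_mul le_m2 le_a2).
  by rewrite -expnD leq_exp2l.
have em2' : m2 = (p ^ 6)%N.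
  exact: nclass_uniq (cohomologous_equiv _) Qm2 (schur_card_abelem p_pr abQ2 oQ2).
have a2_gt1 : (1 < a2)%N.
  rewrite ltnNge; apply/negP => le_a2; have := leq_trans le_ma2 (leq_mul (leqnn m2) le_a2).
  by rewrite muln1 em2' leq_exp2l.
have [f2 [Hf2 tf2]] := theta_nontrivial Zk2 Qa2 a2_gt1.
have oZQ := card_center_theta p_pr pQ Zk2 ok2 abQ2 Hf2 tf2 nabelQ.
pose R := (coset <[k]> @*^-1 'Z(G / <[k]>))%G.
have sRG : R \subset G.
  by rewrite -(quotientGK nsKG) morphpreS ?center_sub.
have oR : #|R| = (p ^ 4)%N.
  rewrite /= card_cosetpre -orderE ok; apply/eqP.
  rewrite -(eqn_pmul2l (_ : 0 < p ^ 2)%N) ?expn_gt0 ?p_gt0 // mulnCA -oZQ oQ.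
  by rewrite -expnD -expnS.
have commR z g : z \in R -> g \in G -> [~ z, g] \in <[k]>.
  move=> Rz Gg; have Gz := subsetP sRG z Rz.
  have [nz ng] := (subsetP nKG z Gz, subsetP nKG g Gg).
  have Zz : coset <[k]> z \in 'Z(G / <[k]>) by case/morphpreP: Rz.
  apply: coset_idr; first by rewrite groupR.
  rewrite morphR //; apply/eqP/commgP; have /centerP[_] := Zz; apply.
  exact: mem_quotient.
have p3 : (a <= p ^ 3)%N -> False.
  by move/(leq_trans ge_a); rewrite leq_exp2l.
(* If [z] in [R] and [g] do not commute, two values of [theta] determine it on [<<g |: R>>], as
   [[R, G]] lies in [<[k]>]. That subgroup has index at most [p] unless [g] is in [R], when two
   values suffice on all of [G]; either way [a <= p ^ 3]. *)
have sRZ : R \subset 'Z(G).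
  apply/subsetP=> z Rz; have Gz := subsetP sRG z Rz.
  apply/centerP; split=> // g Gg; apply/commgP/negPn/negP => ntzg; apply: p3.
  have tR f : is_2cocycle G f -> (forall x, x \in [:: z; g] -> theta f k x = 1%R) ->
      theta f k z = 1%R /\ theta f k g = 1%R.
    by move=> _ t; split; apply: t; rewrite !inE eqxx ?orbT.
  have sS0 : {subset [:: z; g] <= G} by move=> u; rewrite !inE => /orP[]/eqP->.
  have [Rg | nRg] := boolP (g \in R).
    have := theta_count_leq pG Zk ok Ga (subxx G) sS0 _.
    rewrite leq_pmul2r ?cardG_gt0 // => H; apply: leq_trans (H _) _; last by rewrite leq_exp2l.
    move=> f Hf /(tR _ Hf)[tz tg] w Gw.
    exact: (theta_commutators_trivial p_pr Zk ok Hf Gz Gg Gw (commR _ _ Rz Gg) (commR _ _ Rg Gw)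
      (commR _ _ Rz Gw) ntzg tz tg).
  have sHG : <<g |: R>> \subset G by rewrite gen_subG subUset sub1set Gg.
  have prRH : R \proper <<g |: R>>%G.
    rewrite properE sub_gen ?subsetUr //=.
    by apply: contra nRg => /subsetP->//; rewrite mem_gen ?setU11.
  have oH := pgroup_proper_card (pgroupS sHG pG) prRH; rewrite oR -expnS in oH.
  have := theta_count_leq pG Zk ok Ga (H := <<g |: R>>%G) sHG sS0 _.
  move=> H; rewrite -(@leq_pmul2r (p ^ 5)) ?expn_gt0 ?p_gt0 //.
  apply: leq_trans (leq_mul (leqnn a) oH) _; apply: leq_trans (H _) _; last first.
    by rewrite oG -!expnD.
  move=> f Hf /(tR _ Hf)[tz tg]; apply: (theta_ker_gen Hf Zk) => [|w].
    by rewrite subUset sub1set Gg.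
  case/setU1P=> [-> // | Rw]; have Gw := subsetP sRG w Rw.
  apply: (theta_commutators_trivial p_pr Zk ok Hf Gz Gg Gw (commR _ _ Rz Gg) _
      (commR _ _ Rz Gw) ntzg tz tg).
  by rewrite -invg_comm groupV commR.
have nabG : ~~ abelian G by apply: contra nabelQ => cGG; apply: quotient_abelian.
have sQ'K2 : (G / <[k]>)^`(1) \subset <[k2]>.
  by apply: der1_min (abelem_abelian abQ2); case/andP: (cycle_central_normal Zk2).
have sG'R : G^`(1) \subset R.
  rewrite -sub_quotient_pre ?(subset_trans (der_sub 1 G)) // quotient_der //.
  by apply: subset_trans sQ'K2 _; rewrite cycle_subG.
have powR x : x \in G -> x ^+ p \in R.
  move=> Gx; have nx := subsetP nKG x Gx.
  apply/morphpreP; split; first exact: groupX.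
  rewrite /= morphX //; apply: subsetP (expg_in_cycle p_pr Zk2 abQ2 (mem_quotient _ Gx)).
  by rewrite cycle_subG.
have := der1_center_index2 sRZ nabG _ powR sG'R.
rewrite oG oR -expnD => /(_ (leqnn _)); apply/negP; rewrite -ltnNge.
have -> : #|G^`(1)| = (p * #|(G / <[k]>)^`(1)|)%N.
  rewrite -quotient_der // card_quotient ?(subset_trans (der_sub 1 G)) //.
  by rewrite -ok orderE Lagrange // cycle_subG.
rewrite -[ltnLHS]muln1 ltn_pmul2l // cardG_gt1.
by apply: contraNneq nabelQ => Q'1; apply/derG1P.
Qed.

End RankSix.

(** * Direct decomposition and conclusion *)

Section Decomposition.
Local Open Scope group_scope.
Variable p : nat.
Hypothesis p_pr : prime p.

(** [H] is nonabelian of order [p ^ 3] with centre [<[k]>], so it meets a complement [E] of [<[k]>]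
    in the centre of [G] trivially. The orders then show that the two fill [G]. *)
Lemma central_decomposition (gT : finGroupType) (G : {group gT}) (k u v : gT) n :
    #|G| = (p ^ n)%N -> k \in 'Z(G) -> #[k] = p -> p.-abelem (G / <[k]>) ->
    (#|G| = p ^ 2 * #|'Z(G)|)%N -> p.-abelem 'Z(G) ->
    u \in G -> v \in G -> [~ u, v] != 1 ->
  let H := <<[set u; v]>> in
  exists E : {group gT}, [/\ H \x E = G, #|H| = (p ^ 3)%N, p.-abelem E & #|E| = (p ^ (n - 3))%N].
Proof.
move=> oG Zk ok abQ oGZ abZ Gu Gv ntuv H.
have p_gt0 := prime_gt0 p_pr; have p_gt1 := prime_gt1 p_pr.
have pG : p.-group G by rewrite /pgroup oG pnatX pnat_id.
have [E [sEZ _ defZ]] := p_abelem_split1 abZ Zk.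
have [_ defKE _ tiKE] := dprodP defZ.
have /andP[sKG nKG] := cycle_central_normal Zk.
have sHG : H \subset G by rewrite gen_subG subUset !sub1set Gu.
have Hu : u \in H by rewrite mem_gen // !inE eqxx.
have Hv : v \in H by rewrite mem_gen // !inE eqxx orbT.
have prK : prime #|<[k]>| by rewrite -orderE ok.
have sKH : <[k]> \subset H.
  apply: prime_meetG prK _; apply/trivgPn; exists [~ u, v] => //.
  by rewrite inE (commg_in_cycle Zk abQ) //= groupR.
have nabH : ~~ abelian H.
  by apply: contra ntuv => /centsP cHH; apply/commgP/cHH.
have pH := pgroupS sHG pG.
have leH : (#|H| <= p ^ 3)%N.
  have nKH := subset_trans sHG nKG.
  have [nu nv] := (subsetP nKG u Gu, subsetP nKG v Gv).
  have oQ w : w \in G -> (#[coset <[k]> w] <= p)%N.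
    move=> Gw; rewrite dvdn_leq // order_dvdn; apply/eqP.
    by have [_ ->] := abelemP p_pr abQ; rewrite ?mem_quotient.
  have -> : #|H| = (p * #|H / <[k]>|)%N.
    by rewrite card_quotient // -{1}ok orderE Lagrange.
  rewrite expnS leq_pmul2l //; pose a := coset <[k]> u; pose b := coset <[k]> v.
  have sHab : H / <[k]> \subset <[a]> <*> <[b]>.
    rewrite quotient_gen; last by rewrite subUset !sub1set nu.
    rewrite gen_subG; apply/subsetP=> _ /morphimP[w _ /set2P[]-> ->].
      by rewrite -cycle_subG joing_subl.
    by rewrite -cycle_subG joing_subr.
  have cab : <[b]> \subset 'C(<[a]>).
    by apply: (sub_abelian_cent2 (abelem_abelian abQ)); rewrite cycle_subG mem_quotient.
  apply: leq_trans (subset_leq_card sHab) _; rewrite cent_joinEr //.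
  apply: leq_trans (_ : #|<[a]>| * #|<[b]>| <= _)%N.
    by rewrite mul_cardG leq_pmulr ?cardG_gt0.
  by rewrite -mulnn leq_mul // -orderE oQ.
have oH : #|H| = (p ^ 3)%N.
  apply/anti_leq; rewrite leH /= (card_pgroup pH) leq_exp2l // ltnNge.
  by apply: contra nabH; apply: p2group_abelian.
have esH : extraspecial H by apply: p3group_extraspecial pH nabH _; rewrite oH pfactorK.
have oZH : #|'Z(H)| = p := card_center_extraspecial pH esH.
have sZHZ w : w \in H -> w \in 'Z(G) -> w \in 'Z(H).
  by move=> Hw /centerP[_ wC]; apply/centerP; split=> // h Hh; apply/wC/(subsetP sHG).
have defK : 'Z(H) = <[k]>.
  apply/esym/eqP; rewrite eqEcard oZH -orderE ok leqnn andbT cycle_subG.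
  by apply: sZHZ => //; rewrite -cycle_subG.
have sEG : E \subset G := subset_trans sEZ (center_sub G).
have tiHE : H :&: E = 1.
  apply/trivgP; rewrite -tiKE subsetI subsetIr andbT -defK.
  by apply/subsetP=> w /setIP[Hw Ew]; apply: sZHZ => //; apply: (subsetP sEZ).
have cHE : E \subset 'C(H).
  by apply: subset_trans sEZ (subset_trans (subsetIr _ _) (centS sHG)).
have oGE : #|G| = (p ^ 3 * #|E|)%N.
  by rewrite oGZ -defKE TI_cardMg // -orderE ok mulnA -expnSr.
have oE : #|E| = (p ^ (n - 3))%N.
  have n3 : (3 <= n)%N.
    by rewrite -(dvdn_Pexp2l _ _ p_gt1) -oG oGE dvdn_mulr.
  apply/eqP; rewrite -(eqn_pmul2l (_ : 0 < p ^ 3)%N) ?expn_gt0 ?p_gt0 //.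
  by rewrite -expnD subnKC // -oGE oG.
exists E; split=> //; last exact: abelemS abZ.
rewrite dprodE //; apply/eqP; rewrite eqEcard mul_subG //=.
by rewrite TI_cardMg // oH oGE.
Qed.

Lemma abelem_row_Zp d : p.-abelem [set: 'rV['Z_p]_d] /\ #|[set: 'rV['Z_p]_d]| = (p ^ d)%N.
Proof.
split; last by rewrite cardsT card_mx card_ord mul1n Zp_cast ?prime_gt1.
apply/abelemP => //; split; first exact: FinRing.zmod_abelian.
move=> x _; rewrite FinRing.zmodXgE; apply/matrixP=> i j.
by rewrite mulmxnE mxE -GRing.mulr_natr pchar_Zp ?prime_gt1 // GRing.mulr0.
Qed.

Lemma isog_dprod_pair (gT aT bT : finGroupType) (G H E : {group gT}) :
    H \x E = G -> H \isog [set: aT] -> E \isog [set: bT] ->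
  G \isog [set: (aT * bT)%type].
Proof.
move=> defG isoH isoE.
have <- : setX [set: aT] [set: bT] = [set: (aT * bT)%type].
  by apply/setP=> -[x y]; rewrite !inE.
apply: isog_dprod defG (setX_dprod [set: aT]%G [set: bT]%G) _ _.
  rewrite -morphim_pairg1; apply: isog_trans isoH _.
  by rewrite sub_isog ?injm_pairg1 ?subsetT.
rewrite -morphim_pair1g; apply: isog_trans isoE _.
by rewrite sub_isog ?injm_pair1g ?subsetT.
Qed.

End Decomposition.

(** * Groups whose multiplier has the prescribed order *)

Section LargeMultiplier.
Local Open Scope group_scope.
Variables (p n m : nat) (gT : finGroupType) (G : {group gT}).
Hypotheses (p_pr : prime p) (oG : #|G| = (p ^ n)%N) (nabG : ~~ abelian G)
  (Gm : schur_card G m) (em : (m * p ^ 5 = p ^ 'C(n, 2))%N) (n_ge6 : (6 <= n)%N).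
Let p_gt0 := prime_gt0 p_pr.
Let p_gt1 := prime_gt1 p_pr.
Let pG : p.-group G. Proof. by rewrite /pgroup oG pnatX pnat_id. Qed.

Lemma large_multiplier_abelem_quotient k a :
    k \in 'Z(G) -> k \in G^`(1) -> #[k] = p -> nclass (is_2cocycle G) (theta_eq G k) a ->
  p.-abelem (G / <[k]>) /\ (a * p ^ 5 = p ^ n)%N.
Proof.
move=> Zk G'k ok Ga.
have [_ oQ] := card_quotient_prime p_pr Zk ok oG.
have pQ : p.-group (G / <[k]>) := quotient_pgroup _ pG.
have [m' Qm'] := schur_card_exists p_pr pQ.
have emp := schur_card_der1 Zk Gm Qm' Ga G'k; rewrite ok in emp.
have [l en] : exists l, n = l.+2 by exists n.-2; lia.
have abQ : p.-abelem (G / <[k]>).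
  apply/negPn/negP => nabQ.
  have [n6 | n_neq6] := eqVneq n 6.
    have := schur_card_nonabelem_quotient p_pr pG Zk ok G'k _ nabQ Gm.
    rewrite -(@ltn_pmul2r (p ^ 5)) ?expn_gt0 ?p_gt0 // em n6 -expnD ltnn.
    by rewrite -n6 => /(_ oG).
  have le_m' := schur_card_nonabelem_leq p_pr pQ nabQ oQ Qm'.
  have le_a := theta_count_leq_nonabelem pG Zk ok Ga nabQ.
  (* The bounds on [m'] and [a * p ^ 2] give ['C(n, 2) <= 'C(n - 2, 2) + n + 3], that is [n <= 6],
     whereas now [n >= 7]. *)
  have E : (m' * (a * p ^ 2) * p ^ 2 = m * p ^ 5)%N.
    have -> : (m' * (a * p ^ 2) * p ^ 2 = m' * a * p ^ 4)%N by ring.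
    by rewrite -emp; ring.
  have := leq_mul (leq_mul le_m' le_a) (leqnn (p ^ 2)).
  rewrite E em oG -!expnD leq_exp2l // en /= !binS !bin1 !bin0.
  by lia.
split=> //.
have em' := nclass_uniq (cohomologous_equiv _) Qm' (schur_card_abelem p_pr abQ oQ).
have E : (m' * (a * p ^ 5) = p ^ ('C(n, 2)).+1)%N by rewrite mulnA -emp mulnAC em expnSr.
apply/eqP; rewrite -(@eqn_pmul2l (p ^ 'C(n.-1, 2))) ?expn_gt0 ?p_gt0 // -{1}em' E -expnD en /=.
by apply/eqP; congr (_ ^ _)%N; rewrite !binS !bin1 !bin0; lia.
Qed.

Lemma large_multiplier :
  [/\ n <= 7,
      n = 7 -> odd p /\ G \isog [set: (p^{1+2} * 'rV['Z_p]_4)%type]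
    & n = 6 -> G \isog [set: ('D_8 * 'rV['Z_2]_3)%type]]%N.
Proof.
have [k [Zk G'k ok]] := nonabelian_central_der1 p_pr pG nabG.
have [a Ga] := nclass_theta Zk.
have [abQ ea] := large_multiplier_abelem_quotient Zk G'k ok Ga.
have le_a := theta_count_abelem_quotient p_pr Zk ok abQ Ga nabG.
have a_pow : a = (p ^ (n - 5))%N.
  apply/eqP; rewrite -(@eqn_pmul2r (p ^ 5)) ?expn_gt0 ?p_gt0 // ea -expnD.
  by rewrite subnK //; lia.
have a_gt1 : (1 < a)%N by rewrite a_pow -(expn0 p) ltn_exp2l //; lia.
have [f [Hf tf]] := theta_nontrivial Zk Ga a_gt1.
have oGZ := card_center_theta p_pr pG Zk ok abQ Hf tf nabG.
split.
- by move: le_a; rewrite a_pow leq_exp2l //; lia.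
- move=> n7; have oddp : odd p.
    have [p2 | //] := even_prime p_pr.
    have := theta_count_abelem_quotient2 p_pr Zk ok abQ Ga p2 nabG.
    by rewrite a_pow n7 p2.
  split=> //; have eG := exponent_theta p_pr Zk ok abQ Hf tf oddp.
  have [u Gu [v Gv ntuv]] := nonabelian_commg nabG.
  have abZ : p.-abelem 'Z(G).
    rewrite abelemE // center_abelian; apply: dvdn_trans eG.
    exact: exponentS (center_sub G).
  have [E [defG oH abE oE]] := central_decomposition p_pr oG Zk ok abQ oGZ abZ Gu Gv ntuv.
  apply: isog_dprod_pair defG _ _.
    have sHG : <<[set u; v]>> \subset G by rewrite gen_subG subUset !sub1set Gu.
    apply: isog_pX1p2 => //.
      apply: (p3group_extraspecial (pgroupS sHG pG)); last by rewrite oH pfactorK.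
      apply: contra ntuv => /centsP cHH; apply/commgP/cHH.
        by rewrite mem_gen // !inE eqxx.
      by rewrite mem_gen // !inE eqxx orbT.
    exact: dvdn_trans (exponentS sHG) eG.
  have [abV oV] := abelem_row_Zp p_pr 4.
  by rewrite (isog_abelem_card _ abE) abV oV oE n7 eqxx.
move=> n6; have p2 : p = 2%N.
  have [// | oddp] := even_prime p_pr.
  have eG := exponent_theta p_pr Zk ok abQ Hf tf oddp.
  have := theta_count_geq_odd p_pr oddp pG Zk ok abQ nabG eG oGZ Ga.
  by rewrite a_pow n6 leq_exp2l.
have tp x : x \in G -> theta f k x <> 1%R -> x ^+ 2 = 1.
  move=> Gx tx; apply/eqP/negPn/negP => ntx; apply: tx.
  by apply: (theta_expg_nontrivial p_pr Zk ok abQ Hf Gx); rewrite p2.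
have [x [y [Gx Gy ntxy ty]]] := theta_nontrivial_pair p_pr Zk ok abQ Hf tf nabG.
(* Both generators must have nontrivial [theta] to be involutions. If [x] fails this, [x * y]
   replaces it without changing noncommutation with [y]. *)
have [u [Gu tu ntuy]] : exists u, [/\ u \in G, theta f k u <> 1%R & [~ u, y] != 1].
  have [tx | ntx] := pselect (theta f k x = 1%R); last by exists x.
  exists (x * y); split; first exact: groupM.
    by rewrite (theta_mulr Hf) // tx GRing.mul1r.
  by rewrite commMgJ commgg mulg1 conjg_eq1.
(* For central [w], [theta] takes the same nontrivial value at [y * w] as at [y]. Hence both
   elements square to [1], and so does [w]. *)
have abZ : p.-abelem 'Z(G).
  apply/abelemP => //; split=> [|w Zw]; first exact: center_abelian.
  have /centerP[Gw wC] := Zw.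
  have : (y * w) ^+ 2 = 1.
    apply: tp; first exact: groupM.
    by rewrite (theta_mulr Hf) // (theta_center p_pr Zk ok abQ Hf nabG Zw) GRing.mulr1.
  by rewrite expgMn; [rewrite (tp y) // mul1g p2 | apply/commute_sym/wC].
have [E [defG oH abE oE]] := central_decomposition p_pr oG Zk ok abQ oGZ abZ Gu Gy ntuy.
rewrite p2 n6 in oH abE oE.
apply: isog_dprod_pair defG _ _.
  have order2 w : w \in G -> theta f k w <> 1%R -> #[w] = 2%N.
    move=> Gw tw; apply: nt_prime_order => //; first exact: tp.
    by apply: contra_not_neq tw => ->; rewrite (theta1r Hf) //; case/centerP: Zk.
  rewrite -[8%N]/((2 ^ 3)%N) -oH; apply: involutions_gen_dihedral.
  - exact: order2.
  - exact: order2.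
  by apply: contraNneq ntuy => ->; rewrite commgg.
have pr2 : prime 2 by [].
have [abV oV] := abelem_row_Zp pr2 3.
by rewrite (isog_abelem_card _ abE) abV oV oE.
Qed.

End LargeMultiplier.

Theorem theorem3p3 (gT : finGroupType) (G : {group gT}) (p n m : nat) :
  prime p -> #|G| = p ^ n -> ~~ abelian G ->
  schur_order G m -> m * p ^ 5 = p ^ ((n * (n - 1))./2) ->
  [/\ n <= 7,
      n = 7 -> odd p /\ G \isog [set: (p^{1+2} * 'rV['Z_p]_4)%type]
    & n = 6 -> G \isog [set: ('D_8 * 'rV['Z_2]_3)%type]].
Proof.
move=> p_pr oG nabG /schur_order_card Gm; rewrite subn1 -bin2 => em.
have [n_ge6 | n_lt6] := leqP 6 n; first exact: large_multiplier em n_ge6.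
by split=> [|n7|n6]; [apply: leq_trans (ltnW n_lt6) _ | rewrite n7 in n_lt6 | rewrite n6 in n_lt6].
Qed.
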